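(* For every integer $k\ge1$, with $n_0:=0$, \begin{align*} &\sum_{n_k\ge \cdots\ge n_1 \ge 0} t^{n_1+\cdots+n_{k}} q^{n_1+\cdots+n_{k-1}} \sum_{j=0}^{2n_k} \begin{bmatrix} 2n_k\\ j\end{bmatrix}_q z^{2j-2n_k}\prod_{i=1}^{k}\frac{(b_ic_itq;q)_{n_i-n_{i-1}}}{(q;q)_{n_i-n_{i-1}}(b_itq,c_itq;q)_{n_i}}\prod_{i=1}^{k-1}(b_{i+1}^{-1},c_{i+1}^{-1};q)_{n_i}(b_{i+1}c_{i+1})^{n_i}\\ &\qquad = \frac{1}{(t,tz^2,tz^{-2};q)_\infty}\sum_{n\ge 0} (-1)^n t^{(k+1)n} q^{kn+\binom{n}{2}} \frac{(q^{n+1};q)_n (t^2q^{2n};q)_\infty}{(tq^n;q)_n (tq^{2n+1};q)_\infty}\\ &\qquad\quad\times \sum_{j=0}^{2n} \frac{(t;q)_j (t;q)_{2n-j} z^{2j-2n}}{(q;q)_j (q;q)_{2n-j}} \cdot \frac{(b_1^{-1},c_1^{-1},\ldots,b_k^{-1},c_k^{-1};q)_n (b_1c_1\cdots b_kc_k)^n}{(b_1tq,c_1tq,\ldots,b_ktq,c_ktq;q)_n}. \end{align*}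
   Context: Here $q,t,z,b_1,c_1,\dots,b_k,c_k$ are complex parameters with $|q|<1$, $|t|<1$, $z\ne0$, $b_i,c_i\ne0$, generic so that all denominators are nonzero and all series converge. The $q$-Pochhammer symbols are $(a;q)_\infty=\prod_{k\ge0}(1-aq^k)$, $(a;q)_n=(a;q)_\infty/(aq^n;q)_\infty$, and $(a_1,\dots,a_M;q)_n=(a_1;q)_n\cdots(a_M;q)_n$ (also for $n=\infty$). The $q$-binomial coefficient is $\begin{bmatrix} M\\ N\end{bmatrix}_q=\frac{(q;q)_M}{(q;q)_N(q;q)_{M-N}}$ for $0\le N\le M$ and $0$ otherwise. *)

(* Defs.v *)
From HB Require Import structures.
From mathcomp Require Import all_boot all_order all_algebra.
From mathcomp Require Import complex.
From mathcomp Require Import all_classical all_reals all_analysis.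

Set Implicit Arguments.
Unset Strict Implicit.
Unset Printing Implicit Defensive.

Import Order.TTheory GRing.Theory Num.Theory.
Import numFieldNormedType.Exports.

Local Open Scope classical_set_scope.
Local Open Scope ring_scope.
Local Open Scope complex_scope.

(* The library puts its topology on (the sort of) an abstract numFieldType, so
   it is not found on R[i] directly; it is found on this repackaging of R[i]. *)
Definition cplx (R : realType) : numClosedFieldType := R[i].

Section QSeries.
Variable C : numFieldType.
Implicit Types (a q t z : C) (b c : nat -> C) (k n j : nat).

Definition qpoch a q n : C := \prod_(i < n) (1 - a * q ^+ i).

Definition qpochoo a q : C := limn (fun n => qpoch a q n).

Lemma qpochD a q m n : qpoch a q (m + n) = qpoch a q m * qpoch (a * q ^+ m) q n.
Proof.
rewrite /qpoch big_split_ord /=; congr (_ * _).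
by apply: eq_bigr => i _; rewrite exprD mulrA.
Qed.

(* qpoch agrees with the definition (a;q)_n = (a;q)_oo / (a q^n;q)_oo whenever
   the latter makes sense. *)
Lemma qpochE a q n : qpochoo (a * q ^+ n) q != 0 ->
  qpoch a q n = qpochoo a q / qpochoo (a * q ^+ n) q.
Proof.
move=> nz; apply/esym/(canLR (mulfK nz)).
have cv : cvgn (fun m => qpoch (a * q ^+ n) q m).
  apply: contrapT => /dvgP dv; move: nz.
  by rewrite /qpochoo dv eqxx.
apply: cvg_lim; first exact: norm_hausdorff.
rewrite -(cvg_shiftn n).
rewrite (_ : (fun m => _) =
    (fun m => qpoch a q n * qpoch (a * q ^+ n) q m)); last first.
  by apply: funext => m; rewrite addnC qpochD.
by apply: cvgM; [exact: cvg_cst | exact: cv].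
Qed.

Definition qbinom q m n : C :=
  if (n <= m)%N then qpoch q q m / (qpoch q q n * qpoch q q (m - n)) else 0.

(* The chains 0 <= n_1 <= ... <= n_k = N, for k >= 1. *)
Definition chains k N : {set k.-tuple 'I_N.+1} :=
  [set s : k.-tuple 'I_N.+1 |
     sorted leq (map val s) && (last 0%N (map val s) == N)].

(* The summand of the multiple sum at s = [:: n_1; ...; n_k]; the parameters
   b_1, ..., b_k, c_1, ..., c_k are the values of b and c at 1, ..., k. *)
Definition multisum_term k q t z b c (s : seq nat) : C :=
  let n i := nth 0%N (0%N :: s) i in
  t ^+ (\sum_(1 <= i < k.+1) n i)
  * q ^+ (\sum_(1 <= i < k) n i)
  * (\sum_(j < (2 * n k).+1)
       qbinom q (2 * n k) j * z ^ ((2 * j)%:Z - (2 * n k)%:Z))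
  * (\prod_(1 <= i < k.+1)
       (qpoch (b i * c i * t * q) q (n i - n i.-1)
        / (qpoch q q (n i - n i.-1)
           * (qpoch (b i * t * q) q (n i) * qpoch (c i * t * q) q (n i)))))
  * (\prod_(1 <= i < k)
       (qpoch (b i.+1)^-1 q (n i) * qpoch (c i.+1)^-1 q (n i)
        * (b i.+1 * c i.+1) ^+ n i)).

(* Since n_k bounds all the other indices, the multiple sum is a series over
   n_k = N whose N-th term is the finite sum over n_1 <= ... <= n_(k-1) <= N. *)
Definition multisum_level k q t z b c N : C :=
  \sum_(s in chains k N) multisum_term k q t z b c (map val s).

Definition rhs_term k q t z b c n : C :=
  (-1) ^+ n * t ^+ (k.+1 * n) * q ^+ (k * n + 'C(n, 2))
  * (qpoch (q ^+ n.+1) q n * qpochoo (t ^+ 2 * q ^+ (2 * n)) q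
     / (qpoch (t * q ^+ n) q n * qpochoo (t * q ^+ (2 * n).+1) q))
  * (\sum_(j < (2 * n).+1)
       qpoch t q j * qpoch t q (2 * n - j) * z ^ ((2 * j)%:Z - (2 * n)%:Z)
       / (qpoch q q j * qpoch q q (2 * n - j)))
  * ((\prod_(1 <= i < k.+1) (qpoch (b i)^-1 q n * qpoch (c i)^-1 q n))
     * (\prod_(1 <= i < k.+1) (b i * c i)) ^+ n
     / \prod_(1 <= i < k.+1)
         (qpoch (b i * t * q) q n * qpoch (c i * t * q) q n)).

End QSeries.

(* Main.v *)
Require Import Defs.
From HB Require Import structures.
From mathcomp Require Import all_boot all_order all_algebra.
From mathcomp Require Import complex.
From mathcomp Require Import all_classical all_reals all_analysis.
From mathcomp Require Import ring.

Import Order.TTheory GRing.Theory Num.Theory.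
Import numFieldNormedType.Exports.

Local Open Scope classical_set_scope.
Local Open Scope ring_scope.

(* With [a = t], the multiple sum over [n_1 <= ... <= n_(k-1)] at fixed
   [n_k = N] is the [beta]-side of the [k]-fold iteration of Bailey's lemma,
   started from the unit Bailey pair; the [alpha]-side is explicit.  Exchanging
   the sums over [N] and [r] in [sum_N delta_N sum_(r <= N) alpha_r / ((q)_(N-r)
   (tq)_(N+r))], where [delta_N = t^N H_(2N)] and [H_n] is the continuous
   q-Hermite polynomial, leaves the conjugate sums
     [S_M = sum_m t^m H_(M+2m) / ((q)_m (t)_(M+m+1))]   with [M = 2r].
   Telescoping shows that [S_M] obeys, up to normalisation, the three-term
   recurrence of the continuous q-ultraspherical polynomials of parameter [t],
   and that [S_0] satisfies a first-order q-difference equation in [t], which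
   evaluates it as an infinite product.  All identities are stated without
   dividing by [q], so that [q = 0] needs no separate treatment. *)

(** * Finite q-series identities *)

Section QPochhammer.
Variable C : numFieldType.
Implicit Types (a q t z u X Y : C) (n m r : nat).

Lemma qpoch0 a q : qpoch a q 0 = 1.
Proof. by rewrite /qpoch big_ord0. Qed.

Lemma qpochS a q n : qpoch a q n.+1 = qpoch a q n * (1 - a * q ^+ n).
Proof. by rewrite /qpoch big_ord_recr. Qed.

Lemma qpochSl a q n : qpoch a q n.+1 = (1 - a) * qpoch (a * q) q n.
Proof.
rewrite -add1n qpochD; congr (_ * _).
by rewrite qpochS qpoch0 mul1r expr0 mulr1.
Qed.

Lemma qpoch_neq0 a q n :
  (forall i, a * q ^+ i != 1) -> qpoch a q n != 0.
Proof.
by move=> h; apply/prodf_neq0 => i _; rewrite subr_eq0 eq_sym.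
Qed.

Lemma qpoch_neq0S a q i :
  (forall n, qpoch a q n != 0) -> 1 - a * q ^+ i != 0.
Proof. by move=> /(_ i.+1); rewrite qpochS mulf_eq0 negb_or => /andP[]. Qed.

(** * The terminating q-Saalschutz sum *)

Section Saalschutz.
Variables (q u X Y : C).
Hypothesis q_nz : forall n, qpoch q q n != 0.
Hypothesis A_nz : forall n, qpoch (u * X * Y) q n != 0.

Let T m i := qpoch u q (m - i) * qpoch X q i * qpoch Y q i * u ^+ i
  / (qpoch q q (m - i) * qpoch q q i * qpoch (u * X * Y) q i).

(* The Wilf-Zeilberger certificate of the recurrence in [m]. *)
Let G m i := if i is i'.+1 then
  - q ^+ (m - i') * qpoch u q (m - i') * qpoch X q i * qpoch Y q i * u ^+ i
    / (qpoch q q (m - i') * qpoch q q i' * qpoch (u * X * Y) q i')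
  else 0.

Let wz m n : (n <= m.+1)%N ->
  \sum_(i < n) ((1 - q ^+ m.+1) * (1 - u * X * Y * q ^+ m) * T m.+1 i
     - (1 - u * X * q ^+ m) * (1 - u * Y * q ^+ m) * T m i) = G m n.
Proof.
elim: n => [|n IH] hn; first by rewrite big_ord0.
rewrite big_ord_recr /= IH ?(ltnW hn)//.
(* Writing [m] as [d + n] removes the truncated subtractions before [field]. *)
rewrite /T /G /=; have -> : m = (m - n + n)%N by rewrite subnK.
set d := (m - n)%N; rewrite -addSn !addnK.
case: n hn @d {IH} => [|n] hn /=.
  set d := (m - 0)%N; rewrite !qpoch0 !expr0 !addn0 (qpochS q q d) (qpochS u).
  rewrite (qpochS X) (qpochS Y) !qpoch0 !expr0 !exprS !expr0.
  have := q_nz d; have := qpoch_neq0S q q d q_nz.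
  move: (qpoch q q d) (qpoch u q d) (q ^+ d) => Q U D h1 h2.
  field; exact/andP.
set d := (m - n.+1)%N; have -> : (d + n.+1 - n = d.+1)%N by rewrite addnS subSn ?leq_addl// addnK.
rewrite !(qpochS X) !(qpochS Y) (qpochS u q d) (qpochS q q d) !(qpochS (u * X * Y)).
rewrite (qpochS q q n) addSnnS !exprD !exprS.
have := q_nz d; have := qpoch_neq0S q q d q_nz.
have := q_nz n; have := qpoch_neq0S q q n q_nz.
have := A_nz n; have := qpoch_neq0S (u * X * Y) q n A_nz.
move: (qpoch q q d) (qpoch u q d) (q ^+ d) (qpoch q q n) (qpoch X q n) => Qd Ud D Qn Xn.
move: (qpoch Y q n) (qpoch _ q n) (q ^+ n) (u ^+ n) => Yn An E Un h1 h2 h3 h4 h5 h6.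
by field; rewrite h1 h2 h3 h4 h5 h6.
Qed.

(** Both sides satisfy the same first-order recurrence in [m]. Reversing
    [(u; q)_(m-i) / (q; q)_(m-i)] would give the usual balanced [3phi2]; the present form avoids
    negative powers of [q]. *)
Lemma q_saalschutz m :
  \sum_(i < m.+1) T m i
  = qpoch (u * X) q m * qpoch (u * Y) q m / (qpoch q q m * qpoch (u * X * Y) q m).
Proof.
elim: m => [|m IH].
  by rewrite big_ord_recr big_ord0 /= /T !qpoch0 expr0 !mulr1 add0r.
have nq := qpoch_neq0S q q m q_nz; have nA := qpoch_neq0S _ q m A_nz.
rewrite -exprS in nq.
have := wz m m.+1 (leqnn _); rewrite sumrB -!mulr_sumr IH => h.
(* The summand [T m.+1 m.+1] left out by [wz] cancels [G m m.+1], which closes the recurrence. *)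
rewrite big_ord_recr /= -[LHS](mulKf (mulf_neq0 nq nA)) [X in _ * X]mulrDr.
move/eqP: h; rewrite subr_eq => /eqP ->; rewrite /T /G !subnn !qpoch0.
rewrite (qpochS q) (qpochS (u * X * Y)) (qpochS (u * X)) (qpochS (u * Y)) -!exprS.
have := q_nz m; have := A_nz m; rewrite expr0 => h1 h2.
by field; rewrite nA nq h1 h2.
Qed.

End Saalschutz.

(** A closed form for every proper partial sum permits an induction on [R]; [R < n] keeps [n - R.+1]
    a genuine difference and [1 - q ^+ n] nonzero. *)
Lemma unit_bailey_pair_partial q t n R :
  (forall n, qpoch q q n != 0) -> (forall n, qpoch t q n != 0) -> (R < n)%N ->
  \sum_(r < R.+1) ((-1) ^+ r * q ^+ 'C(r, 2) * (1 - t * q ^+ (2 * r)) * qpoch t q r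
     / ((1 - t) * qpoch q q r)) / (qpoch q q (n - r) * qpoch (t * q) q (n + r))
  = (-1) ^+ R * q ^+ 'C(R.+1, 2) * qpoch (t * q) q R
    / (qpoch q q R * qpoch q q (n - R.+1) * qpoch (t * q) q (n + R) * (1 - q ^+ n)).
Proof.
move=> q_nz t_nz.
have t1 : 1 - t != 0 by have := qpoch_neq0S t q 0 t_nz; rewrite expr0 mulr1.
have tq_nz m : qpoch (t * q) q m != 0.
  by have := t_nz m.+1; rewrite qpochSl mulf_eq0 negb_or => /andP[].
elim: R => [|R IH] hR.
  case: n hR => // n _; rewrite big_ord_recr big_ord0 /= !qpoch0 addn0 subn0 muln0.
  rewrite subSS subn0 bin0n /= !expr0 (qpochS q) -exprS.
  have := q_nz n; have := qpoch_neq0S q q n q_nz; rewrite -exprS => h1 h2.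
  have h3 := tq_nz n.+1.
  by field; rewrite h1 h2 t1 h3.
rewrite big_ord_recr /= IH ?(ltnW hR)//.
have -> : n = (n - R.+2 + R.+2)%N by rewrite subnK.
set d := (n - R.+2)%N; rewrite addnK.
have -> : (d + R.+2 - R.+1 = d.+1)%N by rewrite addnS subSn ?leq_addl// addnK.
rewrite [(d + R.+2 + R.+1)%N]addnS; set w := (d + R.+2 + R)%N.
have hw : q ^+ w = q ^+ d * (q * (q * q ^+ R)) * q ^+ R by rewrite !exprD !exprS.
have hn : q ^+ (d + R.+2) = q ^+ d * (q * (q * q ^+ R)) by rewrite !exprD !exprS.
have hB : q ^+ 'C(R.+2, 2) = q ^+ 'C(R.+1, 2) * (q * q ^+ R).
  by rewrite (binS R.+1) bin1 exprD exprS.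
have h2 : q ^+ (2 * R.+1) = (q * q ^+ R) * (q * q ^+ R) by rewrite mul2n -addnn exprD exprS.
have h1 : 1 - q ^+ (d + R.+2) != 0.
  by rewrite addnS exprS; exact: qpoch_neq0S.
rewrite (qpochS (t * q) q w) (qpochS q q d) (qpochS (t * q) q R) (qpochS q q R).
rewrite (qpochSl t q R).
have := qpoch_neq0S (t * q) q w tq_nz; have := tq_nz w; move: h1.
have := q_nz d; have := qpoch_neq0S q q d q_nz.
have := q_nz R; have := qpoch_neq0S q q R q_nz.
rewrite hw hn hB h2 (exprS (-1)).
move: (qpoch (t * q) q w) (qpoch (t * q) q R) (qpoch q q d) (qpoch q q R) => V TR Qd QR.
move: (q ^+ 'C(R.+1, 2)) (q ^+ d) (q ^+ R) ((-1) ^+ R) => B D E s.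
move=> k1 k2 k3 k4 k5 k6 k7.
by field; rewrite k1 k2 k3 k4 k5 k6 k7 t1.
Qed.

(** For positive [n], the last term [r = n] is the negative of the partial sum up to [n - 1]. The
    summand contains [alpha_r] of the unit Bailey pair at [a = t]. *)
Lemma unit_bailey_pair q t n :
  (forall n, qpoch q q n != 0) -> (forall n, qpoch t q n != 0) ->
  \sum_(r < n.+1) ((-1) ^+ r * q ^+ 'C(r, 2) * (1 - t * q ^+ (2 * r)) * qpoch t q r
     / ((1 - t) * qpoch q q r)) / (qpoch q q (n - r) * qpoch (t * q) q (n + r))
  = (n == 0%N)%:R.
Proof.
move=> q_nz t_nz.
have t1 : 1 - t != 0 by have := qpoch_neq0S t q 0 t_nz; rewrite expr0 mulr1.
have tq_nz m : qpoch (t * q) q m != 0.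
  by have := t_nz m.+1; rewrite qpochSl mulf_eq0 negb_or => /andP[].
case: n => [|n].
  by rewrite big_ord_recr big_ord0 /= !qpoch0 !expr0 !mulr1 add0r invr1 mulr1 mul1r divff.
rewrite big_ord_recr /= unit_bailey_pair_partial// !subnn !qpoch0.
rewrite [(n.+1 + n.+1)%N]addnS; set w := (n.+1 + n)%N.
have hw : q ^+ w = q * q ^+ n * q ^+ n by rewrite exprD exprS.
have h2 : q ^+ (2 * n.+1) = (q * q ^+ n) * (q * q ^+ n) by rewrite mul2n -addnn exprD exprS.
rewrite (qpochS (t * q) q w) (qpochS q q n) (qpochSl t).
have := qpoch_neq0S (t * q) q w tq_nz; have := tq_nz w.
have := q_nz n; have := qpoch_neq0S q q n q_nz.
rewrite hw h2 !(exprS _ n).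
move: (qpoch (t * q) q w) (qpoch q q n) (qpoch (t * q) q n) => V Qn Tn.
move: ((-1) ^+ n) (q ^+ n) (q ^+ 'C(n.+1, 2)) => s E B k1 k2 k3 k4.
by field; rewrite k1 k2 k3 k4 t1.
Qed.

End QPochhammer.

Arguments qpoch0 {C}.
Arguments qpochS {C}.
Arguments qpochSl {C}.
Arguments qpoch_neq0 {C}.
Arguments qpoch_neq0S {C}.

(** * Geometrically dominated series in [R[i]] *)

(** The substitution [N = r + m], used both for Bailey's lemma and for the exchange of series. *)
Lemma sum_triangle (V : nmodType) (f : nat -> nat -> V) L :
  \sum_(N < L) \sum_(r < N.+1) f r (N - r)%N = \sum_(r < L) \sum_(m < L - r) f r m.
Proof.
elim: L => [|L IH]; first by rewrite !big_ord0.
rewrite big_ord_recr /= IH [RHS]big_ord_recr /= [X in _ + X]big_ord_recr /=.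
rewrite subSnn big_ord_recr big_ord0 /= subnn add0r addrA; congr (_ + _).
rewrite -big_split /=; apply: eq_bigr => i _.
by rewrite subSn ?(ltnW (ltn_ord i))// big_ord_recr.
Qed.

Section Geometric.
Variable R : realType.
Local Notation C := (cplx R).
Implicit Types (a q r K : C) (u v : nat -> C).

Lemma ge0_RRe (x : C) : 0 <= x -> x = ((complex.Re x)%:C)%C.
Proof. by move=> x0; rewrite [RHS]RRe_real// ger0_real. Qed.

(** The order on [C] is partial, but the sign hypotheses make [r] and [e] real, which reduces the
    claim to real geometric sequences. *)
Lemma expr_lt_small r e : 0 <= r -> r < 1 -> 0 < e ->
  exists N, forall n, (N <= n)%N -> r ^+ n < e.
Proof.
move=> r0 r1 e0.
have r0' : 0 <= complex.Re r by move: (r0); rewrite lecE => /andP[].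
have r1' : complex.Re r < 1 by move: (r1); rewrite ltcE => /andP[].
have e0' : 0 < complex.Re e by move: (e0); rewrite ltcE => /andP[].
have := @cvg_expr R (complex.Re r); rewrite ger0_norm// => /(_ r1').
move=> /cvgr0Pnorm_lt /(_ _ e0')[N _ hN]; exists N => n /hN /=.
rewrite (ge0_RRe r r0) (ge0_RRe e (ltW e0)) -(rmorphXn (@real_complex R)) ltcR.
by rewrite ger0_norm// exprn_ge0.
Qed.

Lemma sum_expr_le r n : 0 <= r -> r < 1 -> \sum_(i < n) r ^+ i <= (1 - r)^-1.
Proof.
move=> r0 r1; have h : 0 < 1 - r by rewrite subr_gt0.
rewrite -[leRHS]mul1r ler_pdivlMr// mulrC -opprB mulNr -subrX1 opprB.
by rewrite gerBl exprn_ge0.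
Qed.

Lemma cvg_norm_le u l K : (forall n, `|u n| <= K) -> u @ \oo --> l -> `|l| <= K.
Proof.
move=> uK ul; rewrite real_leNgt ?normr_real//; last first.
  exact/ger0_real/(le_trans _ (uK 0%N)).
apply/negP => h; have {}h : 0 < `|l| - K by rewrite subr_gt0.
move/(@cvgrPdist_lt C C): ul => /(_ _ h)[N _ /(_ N (leqnn N))] /=.
apply/negP; rewrite -real_leNgt ?normr_real ?gtr0_real//.
rewrite lerBlDr (le_trans _ (lerD (lexx _) (uK N)))//.
by rewrite -{1}(subrK (u N) l) ler_normD.
Qed.

(** A geometric majorant gives convergence with explicit tails and survives multiplication by a
    [bnd] sequence, which is how the series below are handled. *)
Definition geo u := exists K r,
  [/\ 0 <= K, 0 <= r, r < 1 & forall n, `|u n| <= K * r ^+ n].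

Definition bnd u := exists2 K, 0 <= K & forall n, `|u n| <= K.

Lemma le_expr_cvg u l K r : 0 <= r -> r < 1 ->
  (forall n, `|l - u n| <= K * r ^+ n) -> u @ \oo --> l.
Proof.
move=> r0 r1 h; have K0 : 0 <= K.
  by have := h 0%N; rewrite expr0 mulr1; apply: le_trans.
apply/(@cvgrPdist_lt C C) => e e0.
(* Division by [K + 1] also covers [K = 0]. *)
have e0' : 0 < e / (K + 1) by rewrite divr_gt0// ltr_wpDl.
have [N hN] := expr_lt_small r _ r0 r1 e0'.
exists N => // n /= /hN; rewrite ltr_pdivlMr ?ltr_wpDl// mulrDr mulr1 mulrC => hn.
apply: le_lt_trans (h n) (le_lt_trans _ hn).
by rewrite lerDl exprn_ge0.
Qed.

Lemma geo_cvg0 u : geo u -> u @ \oo --> (0 : C).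
Proof.
move=> [K [r [K0 r0 r1 h]]]; apply: (le_expr_cvg _ _ K r) => // n.
by rewrite sub0r normrN.
Qed.

Lemma geo_series_tail u K r n m : 0 <= K -> 0 <= r -> r < 1 ->
  (forall n, `|u n| <= K * r ^+ n) ->
  `|series u (n + m)%N - series u n| <= K / (1 - r) * r ^+ n.
Proof.
move=> K0 r0 r1 h; rewrite !seriesEord /= big_split_ord /= addrAC subrr add0r.
apply: le_trans (ler_norm_sum _ _ _) _.
apply: (@le_trans _ _ (\sum_(i < m) K * r ^+ n * r ^+ i)).
  by apply: ler_sum => i _; rewrite -mulrA -exprD.
rewrite -mulr_sumr [leRHS]mulrAC ler_wpM2l ?mulr_ge0 ?exprn_ge0//.
exact: sum_expr_le.
Qed.

(** The real and imaginary parts are dominated by one real geometric series, hence converge, and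
    their limits form the complex limit [l]. *)
Lemma geo_is_cvg_series u : geo u -> cvgn (series u).
Proof.
move=> [K [r [K0 r0 r1 h]]].
have KE := ge0_RRe K K0; have rE := ge0_RRe r r0.
have r0' : 0 <= complex.Re r by move: (r0); rewrite lecE => /andP[].
have r1' : `|complex.Re r| < 1 by rewrite ger0_norm//; move: (r1); rewrite ltcE => /andP[].
have K0' : 0 <= complex.Re K by move: (K0); rewrite lecE => /andP[].
have hE n : K * r ^+ n = ((complex.Re K * complex.Re r ^+ n)%:C)%C.
  by rewrite {1}KE {1}rE rmorphM rmorphXn.
have dom (v : nat -> R) : (forall n, (`|v n|%:C)%C <= `|u n|) -> cvgn (series v).
  move=> hv; apply: normed_cvg.
  apply: (@series_le_cvg _ _ (geometric (complex.Re K) (complex.Re r))) => [n|n|n|] //=.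
  - by rewrite mulr_ge0// exprn_ge0.
  - by rewrite -lecR -hE (le_trans (hv n)).
  - exact: is_cvg_geometric_series.
have cr : cvgn (series (fun n => complex.Re (u n))).
  by apply: dom => n; exact: normc_ge_Re.
have ci : cvgn (series (fun n => complex.Im (u n))).
  (* The real part of [u n * 'i] is minus the imaginary part of [u n]. *)
  apply: dom => n; have := normc_ge_Re (u n * 'i%C).
  by rewrite ReiNIm !normrN normrM complexiE normCi mulr1.
set l : C := (limn (series (fun n => complex.Re (u n)))
              +i* limn (series (fun n => complex.Im (u n))))%C.
apply: (@cvgP C _ l); apply/(@cvgrPdist_lt C C) => e e0.
have e0' : 0 < complex.Re e / 2.
  by rewrite divr_gt0//; move: (e0); rewrite ltcE => /andP[].
have /cvgrPdist_lt/(_ _ e0')[N1 _ h1] := cr; have /cvgrPdist_lt/(_ _ e0')[N2 _ h2] := ci.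
exists (N1 + N2)%N => // n /= hn.
have {}h1 := h1 n (leq_trans (leq_addr _ _) hn); have {}h2 := h2 n (leq_trans (leq_addl _ _) hn).
rewrite [X in `|X|](complexE (l - series u n)).
apply: le_lt_trans (ler_normD _ _) _; rewrite normrM complexiE normCi mul1r.
have sE m : series u m = (series (fun n => complex.Re (u n)) m
                          +i* series (fun n => complex.Im (u n)) m)%C.
  rewrite !seriesEord /=; elim: m => [|m IH]; first by rewrite !big_ord0.
  by rewrite !big_ord_recr /= IH; case: (u m).
have nE (x : R) : `|(x%:C)%C| = (`|x|%:C)%C by rewrite normc_def /= expr0n addr0 sqrtr_sqr.
rewrite sE !nE /= -(rmorphD (@real_complex R)) (ge0_RRe e (ltW e0)) ltcR.
by rewrite [ltRHS]splitr ltrD.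
Qed.

Lemma bnd_shift u s : bnd (fun n => u (s + n)%N) -> bnd u.
Proof.
move=> [K K0 h]; have S0 : 0 <= \sum_(i < s) `|u i| by exact: sumr_ge0.
exists (K + \sum_(i < s) `|u i|) => [|n]; first exact: addr_ge0.
case: (leqP s n) => [/subnKC <-|hn]; first by apply: ler_wpDr.
apply: ler_wpDl => //; rewrite (bigD1 (Ordinal hn)) //= lerDl.
exact: sumr_ge0.
Qed.

Lemma bndM u v : bnd u -> bnd v -> bnd (fun n => u n * v n).
Proof.
move=> [K K0 hu] [L L0 hv]; exists (K * L) => [|n]; first exact: mulr_ge0.
by rewrite normrM ler_pM.
Qed.

Lemma bnd_cst a : bnd (fun=> a).
Proof. by exists `|a|. Qed.

Lemma bndD u v : bnd u -> bnd v -> bnd (fun n => u n + v n).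
Proof.
move=> [K K0 hu] [L L0 hv]; exists (K + L) => [|n]; first exact: addr_ge0.
by rewrite (le_trans (ler_normD _ _))// lerD.
Qed.

Lemma bndB u v : bnd u -> bnd v -> bnd (fun n => u n - v n).
Proof.
move=> hu [L L0 hv]; apply: (bndD u (fun n => - v n)) => //.
by exists L => // n; rewrite normrN.
Qed.

Lemma bnd_comp u (g : nat -> nat) : bnd u -> bnd (fun n => u (g n)).
Proof. by move=> [K K0 h]; exists K. Qed.

Lemma bnd_expr a : `|a| <= 1 -> bnd (fun n => a ^+ n).
Proof. by move=> a1; exists 1 => // n; rewrite normrX exprn_ile1. Qed.

Lemma bnd_prod (I : Type) (s : seq I) (P : pred I) (f : I -> nat -> C) :
  (forall i, P i -> bnd (f i)) -> bnd (fun n => \prod_(i <- s | P i) f i n).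
Proof.
move=> h; elim: s => [|i s [K K0 IH]].
  by exists 1 => // n; rewrite big_nil normr1.
have [Pi|nPi] := boolP (P i); last first.
  by exists K => // n; rewrite big_cons (negbTE nPi).
have [L L0 hL] := h i Pi; exists (L * K) => [|n]; first exact: mulr_ge0.
by rewrite big_cons Pi normrM ler_pM.
Qed.

Lemma eq_bnd u v : u =1 v -> bnd v -> bnd u.
Proof. by move=> uv [K K0 h]; exists K => // n; rewrite uv. Qed.

Lemma geoM u v : geo u -> bnd v -> geo (fun n => u n * v n).
Proof.
move=> [K [r [K0 r0 r1 h]]] [L L0 hv]; exists (K * L), r.
split => // [|n]; first exact: mulr_ge0.
by rewrite normrM mulrAC ler_pM.
Qed.

Lemma geo_shift u : geo u -> geo (fun n => u n.+1).
Proof.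
move=> [K [r [K0 r0 r1 h]]]; exists (K * r), r; split=> // [|n]; first exact: mulr_ge0.
by rewrite -mulrA -exprS.
Qed.

Lemma eq_geo u v : u =1 v -> geo v -> geo u.
Proof. by move=> uv [K [r [K0 r0 r1 h]]]; exists K, r; split=> // n; rewrite uv. Qed.

(** Bernoulli's inequality for [1 + d], with [d = (1 - r) / 2], absorbs the linear factor, while
    [r * (1 + d)] stays below [1]. *)
Lemma natr_expr_le r : 0 <= r -> r < 1 -> exists K r', [/\ 0 <= K, 0 <= r', r' < 1 &
  forall n, n.+1%:R * r ^+ n <= K * r' ^+ n].
Proof.
move=> r0 r1; have [d dE] : exists d, d = (1 - r) / 2 by exists ((1 - r) / 2).
have d0 : 0 < d by rewrite dE divr_gt0// subr_gt0.
have d1 : 0 <= 1 + d by rewrite addr_ge0// ltW.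
have bern n : 1 + n%:R * d <= (1 + d) ^+ n.
  elim: n => [|n IH]; first by rewrite mul0r addr0 expr0.
  rewrite exprS (le_trans _ (ler_wpM2l d1 IH))//.
  have -> : (1 + d) * (1 + n%:R * d) = 1 + n.+1%:R * d + n%:R * (d * d).
    by rewrite -natr1; ring.
  by rewrite lerDl !mulr_ge0 ?ler0n ?(ltW d0).
exists (1 + d^-1), (r * (1 + d)); split.
- by rewrite addr_ge0// invr_ge0 ltW.
- exact: mulr_ge0.
- have -> : r * (1 + d) = 1 - (1 - r) * (2 - r) / 2 by rewrite dE; field.
  rewrite gtrBl divr_gt0// mulr_gt0// subr_gt0//.
  by rewrite (lt_trans r1)// ltr1n.
- move=> n; rewrite exprMn mulrC mulrCA ler_wpM2l ?exprn_ge0//.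
  apply: le_trans (ler_wpM2l _ (bern n)); last by rewrite addr_ge0// invr_ge0 ltW.
  have -> : (1 + d^-1) * (1 + n%:R * d) = n.+1%:R + (d^-1 + n%:R * d).
    by rewrite -natr1; field; rewrite gt_eqF.
  by rewrite lerDl addr_ge0 ?invr_ge0 ?mulr_ge0 ?ler0n ?(ltW d0).
Qed.

(** Ratio test: from [s] on, the norm of [u n / r ^+ n] does not increase. *)
Lemma geo_ratio u r s : 0 < r -> r < 1 ->
  (forall n, (s <= n)%N -> `|u n.+1| <= r * `|u n|) -> geo u.
Proof.
move=> r0 r1 h.
have [K K0 hK] : bnd (fun n => u n / r ^+ n).
  apply: (bnd_shift _ s); exists (`|u s| / r ^+ s) => [|n].
    by rewrite divr_ge0// exprn_ge0// ltW.
  rewrite normrM normfV normrX (gtr0_norm r0).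
  rewrite ler_pdivrMr ?exprn_gt0// exprD mulrA divfK ?expf_neq0 ?gt_eqF//.
  elim: n => [|n IH]; first by rewrite addn0 expr0 mulr1.
  by rewrite addnS (le_trans (h _ (leq_addr _ _)))// exprS mulrCA ler_wpM2l// ltW.
exists K, r; split => // [|n]; first exact: ltW.
have := hK n; rewrite normrM normfV normrX (gtr0_norm r0).
by rewrite ler_pdivrMr// exprn_gt0.
Qed.

(** Consecutive terms have ratio [q ^+ n * a], eventually at most [2^-1] in norm. In the choice of
    [s], [|a| + 1] replaces [|a|] so that [a = 0] is covered. *)
Lemma geo_qexpC2 q a : `|q| < 1 -> geo (fun n => q ^+ 'C(n, 2) * a ^+ n).
Proof.
move=> q1; have a0 : 0 < `|a| + 1 by rewrite ltr_wpDl.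
have e0 : 0 < 2^-1 / (`|a| + 1) by rewrite divr_gt0// invr_gt0.
have [s hs] := expr_lt_small _ _ (normr_ge0 q) q1 e0.
apply: (geo_ratio _ 2^-1 s); rewrite ?invr_gt0 ?invf_lt1 ?ltr1n// => n /hs hn.
rewrite binS bin1 exprD exprSr mulrACA [leLHS]normrM [leLHS]mulrC ler_wpM2r//.
rewrite normrM normrX; move: hn; rewrite ltr_pdivlMr// => /ltW.
by apply: le_trans; rewrite ler_wpM2l ?exprn_ge0// lerDl.
Qed.

(** * Bounds and convergence of q-Pochhammer symbols *)

Section QPochhammerBounds.
Variables (a q : C).
Hypothesis q1 : `|q| < 1.

Lemma weierstrass_prod (v : nat -> C) n : (forall i, 0 <= v i <= 1) ->
  1 - \sum_(i < n) v i <= \prod_(i < n) (1 - v i).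
Proof.
move=> h; elim: n => [|n IH]; first by rewrite !big_ord0 subr0.
have /andP[v0 v1] := h n; rewrite !big_ord_recr /= mulrDr mulr1 mulrN opprD addrA.
apply: lerB => //; rewrite ler_piMl// prodr_ile1// => i _; have /andP[w0 w1] := h i.
by rewrite subr_ge0 w1 gerBl.
Qed.

(** Choose [s] so that the norms [v i] of [a * q ^+ s * q ^+ i] sum to at most [2^-1]. The
    Weierstrass inequality bounds the product of the [1 - v i] below by [2^-1], and
    [(1 + v i) * (1 - v i) <= 1] then gives the upper bound [2]. *)
Lemma qpoch_tail : exists s, forall n,
  2^-1 <= `|qpoch (a * q ^+ s) q n| /\ `|qpoch (a * q ^+ s) q n| <= 2.
Proof.
have a0 : 0 < `|a| + 1 by rewrite ltr_wpDl.
have q1' : 0 < 1 - `|q| by rewrite subr_gt0.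
have e0 : 0 < 2^-1 * (1 - `|q|) / (`|a| + 1).
  by rewrite divr_gt0// mulr_gt0// invr_gt0.
have [s hs] := expr_lt_small _ _ (normr_ge0 q) q1 e0.
exists s => n; pose v i := `|a * q ^+ s * q ^+ i|.
have vE i : v i = `|a| * `|q| ^+ s * `|q| ^+ i by rewrite /v !normrM !normrX.
have hs' : `|a| * `|q| ^+ s <= 2^-1 * (1 - `|q|).
  have := hs s (leqnn s); rewrite ltr_pdivlMr// => /ltW; apply: le_trans.
  by rewrite mulrC ler_wpM2l ?exprn_ge0// lerDl.
have sv : \sum_(i < n) v i <= 2^-1.
  under eq_bigr do rewrite vE; rewrite -mulr_sumr.
  apply: (@le_trans _ _ (`|a| * `|q| ^+ s * (1 - `|q|)^-1)).
    by rewrite ler_wpM2l ?mulr_ge0 ?exprn_ge0// sum_expr_le.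
  by rewrite ler_pdivrMr.
have v01 i : 0 <= v i <= 1.
  rewrite normr_ge0 vE /= -[leRHS](mulr1 1) ler_pM ?mulr_ge0 ?exprn_ge0//; last first.
    by rewrite exprn_ile1// ltW.
  apply: le_trans hs' _; apply: mulr_ile1.
  - by rewrite invr_ge0.
  - exact: ltW.
  - by rewrite invf_le1// ler1n.
  - by rewrite gerBl.
have low : 2^-1 <= \prod_(i < n) (1 - v i).
  apply: le_trans _ (weierstrass_prod v n v01).
  by rewrite lerBrDr -lerBrDl [leRHS](_ : _ = 2^-1)//; field.
rewrite /qpoch normr_prod; split.
  apply: le_trans low _; apply: ler_prod => i _; have /andP[_ v1] := v01 i.
  by rewrite subr_ge0 v1 /= -{1}normr1 lerB_dist.
apply: (@le_trans _ _ (\prod_(i < n) (1 + v i))).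
  by apply: ler_prod => i _; rewrite normr_ge0 /= -{2}normr1 ler_normB.
have P0 : 0 <= \prod_(i < n) (1 + v i).
  by apply: prodr_ge0 => i _; have /andP[v0 _] := v01 i; rewrite addr_ge0.
rewrite -[2]invrK -[leRHS]mul1r ler_pdivlMr ?invr_gt0//.
apply: le_trans (ler_wpM2l P0 low) _; rewrite -big_split /= prodr_ile1// => i _.
have /andP[v0 v1] := v01 i; have v1' : 0 <= 1 - v i by rewrite subr_ge0.
apply/andP; split; first by apply: mulr_ge0 => //; exact: addr_ge0.
by rewrite mulrC -subr_sqr expr1n gerBl exprn_ge0.
Qed.

Lemma bnd_qpoch : bnd (qpoch a q).
Proof.
have [s hs] := qpoch_tail; apply: (bnd_shift _ s).
apply: (eq_bnd _ (fun n => qpoch a q s * qpoch (a * q ^+ s) q n)) => [n|].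
  by rewrite qpochD.
by apply: bndM; [exact: bnd_cst | exists 2 => // n; have [] := hs n].
Qed.

(** The tail beyond [s] is at least [2^-1] in norm; if [(a; q)_s] vanishes, its inverse is the
    default [0] and the bound still holds. *)
Lemma bnd_qpochV : bnd (fun n => (qpoch a q n)^-1).
Proof.
have [s hs] := qpoch_tail; apply: (bnd_shift _ s).
apply: (eq_bnd _ (fun n => (qpoch a q s)^-1 * (qpoch (a * q ^+ s) q n)^-1)) => [n|].
  by rewrite qpochD invfM.
apply: bndM; [exact: bnd_cst | exists 2 => // n; have [h _] := hs n].
rewrite normfV -[leRHS]invrK lef_pV2// posrE ?invr_gt0//.
by apply: lt_le_trans h; rewrite invr_gt0.
Qed.

(** Telescoping writes [qpoch a q n] as [1] plus a series whose [i]-th term is [q ^+ i] times a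
    bounded factor. *)
Lemma is_cvg_qpoch : cvgn (qpoch a q).
Proof.
have E n : qpoch a q n = 1 + series (fun i => - (a * q ^+ i) * qpoch a q i) n.
  rewrite seriesEord /=; elim: n => [|n IH]; first by rewrite qpoch0 big_ord0 addr0.
  by rewrite big_ord_recr /= addrA -IH qpochS mulrBr mulr1 mulNr [X in _ - X]mulrC.
have g : geo (fun i => - (a * q ^+ i) * qpoch a q i).
  apply: geoM bnd_qpoch; exists `|a|, `|q|; split=> // n.
  by rewrite normrN normrM normrX.
have /cvg_ex[l hl] := geo_is_cvg_series _ g.
apply/cvg_ex; exists (1 + l).
rewrite (_ : qpoch a q = fun n =>
  1 + series (fun i => - (a * q ^+ i) * qpoch a q i) n); last exact/funext.
by apply: (@cvgD C C); [exact: cvg_cst | exact: hl].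
Qed.

Lemma cvg_qpoch : qpoch a q @ \oo --> qpochoo a q.
Proof. exact: is_cvg_qpoch. Qed.

(** The inverses are bounded, so the nonzero values [qpoch a q n] stay away from [0]. *)
Lemma qpochoo_neq0 : (forall n, qpoch a q n != 0) -> qpochoo a q != 0.
Proof.
move=> nz; apply/eqP => l0; have [K K0 hK] := bnd_qpochV.
have e0 : 0 < (K + 1)^-1 by rewrite invr_gt0 ltr_wpDl.
have := cvg_qpoch; rewrite l0 => /(@cvgr0Pnorm_lt C C)/(_ _ e0)[N _ /(_ N (leqnn N))] /=.
rewrite -[ltLHS]invrK ltf_pV2 ?posrE ?ltr_wpDl// ?invr_gt0 ?normr_gt0//.
rewrite -normfV => /lt_le_trans/(_ (hK N)).
by rewrite gtrDl ltr10.
Qed.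

End QPochhammerBounds.

Lemma qpochoo_split a q n : `|q| < 1 -> qpochoo a q = qpoch a q n * qpochoo (a * q ^+ n) q.
Proof.
move=> q1; apply: (@cvg_lim C) => //; rewrite -(cvg_shiftn n).
rewrite (_ : (fun m => _) = (fun m => qpoch a q n * qpoch (a * q ^+ n) q m)); last first.
  by apply/funext => m; rewrite addnC qpochD.
by apply: (@cvgM C); [exact: cvg_cst | exact: cvg_qpoch].
Qed.

Lemma geo_series_lim_tail u K r n : 0 <= K -> 0 <= r -> r < 1 ->
  (forall n, `|u n| <= K * r ^+ n) ->
  `|limn (series u) - series u n| <= K / (1 - r) * r ^+ n.
Proof.
move=> K0 r0 r1 h; have g : geo u by exists K, r.
apply: (cvg_norm_le (fun m => series u (m + n)%N - series u n)).
  by move=> m; rewrite addnC; exact: geo_series_tail.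
apply: (@cvgB C C); last exact: cvg_cst.
rewrite (cvg_shiftn n (series u)); exact: geo_is_cvg_series.
Qed.

(* The partial sums up to [L] of the two sides differ by at most
   [(sum_i |al i|) * K * r ^+ L / (1 - r)]. *)
Lemma cvg_series_exchange (al : nat -> C) (d : nat -> nat -> C) K r :
  geo al -> 0 <= K -> 0 <= r -> r < 1 ->
  (forall i m, `|d i m| <= K * r ^+ (i + m)) ->
  let ga i := limn (series (d i)) in
  geo (fun i => al i * ga i) /\
  series (fun N => \sum_(i < N.+1) al i * d i (N - i)%N) @ \oo -->
    limn (series (fun i => al i * ga i)).
Proof.
move=> [K' [r' [K0' r0' r1' hal]]] K0 r0 r1 hd ga.
have hd' i m : `|d i m| <= K * r ^+ i * r ^+ m by rewrite -mulrA -exprD.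
have Ki i : 0 <= K * r ^+ i by rewrite mulr_ge0// exprn_ge0.
have r10 : 0 <= (1 - r)^-1 by rewrite invr_ge0 subr_ge0 ltW.
have r10' : 0 <= (1 - r')^-1 by rewrite invr_ge0 subr_ge0 ltW.
have tail i n : `|ga i - series (d i) n| <= K / (1 - r) * r ^+ (i + n).
  rewrite exprD mulrA -(mulrAC K); exact: geo_series_lim_tail.
have g : geo (fun i => al i * ga i).
  apply: geoM; first by exists K', r'.
  exists (K / (1 - r)) => [|i]; first exact: mulr_ge0.
  have := tail i 0%N; rewrite seriesEord /= big_ord0 subr0 => /le_trans; apply.
  by rewrite ler_piMr ?mulr_ge0// exprn_ile1// ltW.
split => //.
(* Summed by rows, the triangle cuts row [i] at [L - i]; the missing tail is of order
   [r ^+ (i + (L - i)) = r ^+ L], uniformly in [i]. *)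
have sE L : series (fun N => \sum_(i < N.+1) al i * d i (N - i)%N) L
    = \sum_(i < L) al i * series (d i) (L - i)%N.
  rewrite seriesEord /= (sum_triangle _ (fun i m => al i * d i m)).
  by apply: eq_bigr => i _; rewrite seriesEord /= mulr_sumr.
have sub L : `|series (fun i => al i * ga i) L
              - series (fun N => \sum_(i < N.+1) al i * d i (N - i)%N) L|
   <= K' / (1 - r') * (K / (1 - r)) * r ^+ L.
  rewrite sE seriesEord /= -sumrB.
  apply: le_trans (ler_norm_sum _ _ _) _.
  apply: (@le_trans _ _ (\sum_(i < L) K' * r' ^+ i * (K / (1 - r) * r ^+ L))).
    apply: ler_sum => i _; rewrite -mulrBr normrM ler_pM//.
    by have := tail i (L - i)%N; rewrite subnKC// ltnW.
  rewrite -mulr_suml -mulr_sumr -!mulrA ler_wpM2l// ler_wpM2r ?mulr_ge0 ?exprn_ge0//.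
  exact: sum_expr_le.
have c1 : (fun L => series (fun i => al i * ga i) L
    - series (fun N => \sum_(i < N.+1) al i * d i (N - i)%N) L) @ \oo --> (0 : C).
  apply: (le_expr_cvg _ _ (K' / (1 - r') * (K / (1 - r))) r) => // n.
  by rewrite sub0r normrN.
rewrite -[limn _]subr0 (_ : series (fun N => _) = fun L => series (fun i => al i * ga i) L -
  (series (fun i => al i * ga i) L - series (fun N => \sum_(i < N.+1) al i * d i (N - i)%N) L)).
  by apply: (@cvgB C C) c1; exact: geo_is_cvg_series.
by apply/funext => L; rewrite opprB addrC subrK.
Qed.

End Geometric.

(** * The Bailey chain *)

(** Chains are built by appending their last entry, so that an induction on [k] adds one Bailey
    step. With [n_0 = 0], the empty chain exists only for [N = 0]. *)
Fixpoint chain_seqs (k N : nat) : seq (seq nat) :=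
  if k is k'.+1 then [seq rcons s N | M <- index_iota 0 N.+1, s <- chain_seqs k' M]
  else if N == 0%N then [:: [::]] else [::].

Lemma chain_seqsS k N : chain_seqs k.+1 N =
  [seq rcons s N | M <- index_iota 0 N.+1, s <- chain_seqs k M].
Proof. by []. Qed.

Lemma sorted_le_last (s : seq nat) x : sorted leq s -> x \in s -> (x <= last 0 s)%N.
Proof.
move=> ss /(nthP 0%N)[i hi <-]; rewrite -nth_last.
have h0 : (0 < size s)%N by exact: leq_ltn_trans hi.
by apply: (sorted_leq_nth leq_trans leqnn 0%N ss); rewrite ?inE ?prednK// -ltnS prednK.
Qed.

Lemma sorted_leq_rcons (s : seq nat) x :
  sorted leq (rcons s x) = sorted leq s && (last 0 s <= x)%N.
Proof. by case: s => [|y s]//=; rewrite rcons_path. Qed.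

Lemma mem_chain_seqs k N s :
  (s \in chain_seqs k N) = [&& size s == k, sorted leq s & last 0%N s == N].
Proof.
elim: k N s => [|k IH] N s; last rewrite chain_seqsS.
  by case: s => [|x s]; case: N.
apply/(@allpairsPdep nat (fun=> seq nat))/and3P => [[M [s' []]]|[]].
  rewrite mem_index_iota ltnS IH => /= hM /and3P[/eqP hs ss /eqP hl] ->.
  by rewrite size_rcons hs sorted_leq_rcons ss hl hM last_rcons.
case/lastP: s => [|s x]//; rewrite size_rcons eqSS sorted_leq_rcons last_rcons.
move=> hs /andP[ss hl] /eqP <-; exists (last 0%N s), s; split=> //.
  by rewrite mem_index_iota ltnS.
by rewrite IH hs ss eqxx.
Qed.

Lemma uniq_chain_seqs k N : uniq (chain_seqs k N).
Proof.
elim: k N => [|k IH] N; [by case: N | rewrite chain_seqsS].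
apply: (@allpairs_uniq_dep nat (fun=> seq nat)); first exact: iota_uniq.
  by move=> M _; exact: IH.
move=> x y /(@allpairsPdep nat (fun=> seq nat))[M [s [_ hs ->]]].
move=> /(@allpairsPdep nat (fun=> seq nat))[M' [s' [_ hs' ->]]] /=.
move=> /rcons_inj[ss]; move: hs hs'; rewrite !mem_chain_seqs ss.
by move=> /and3P[_ _ /eqP <-] /and3P[_ _ /eqP <-].
Qed.

Lemma big_chains (V : nmodType) k N (F : seq nat -> V) :
  \sum_(s in chains k N) F (map val s) = \sum_(s <- chain_seqs k N) F s.
Proof.
rewrite -big_enum /= -(big_map (fun s : k.-tuple 'I_N.+1 => map val s) predT F).
apply: perm_big; apply: uniq_perm.
- rewrite map_inj_uniq ?enum_uniq// => s1 s2 /(inj_map val_inj) h.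
  exact: val_inj.
- exact: uniq_chain_seqs.
move=> s; rewrite mem_chain_seqs; apply/mapP/and3P => [[s' hs' ->]|[/eqP hs ss /eqP hl]].
  by move: hs'; rewrite mem_enum inE size_map size_tuple eqxx => /andP[].
(* Every entry is at most the last one, [N], so [inord] preserves its value. *)
have sE : map val (map (@inord N) s) = s.
  rewrite -map_comp map_id_in// => x hx /=.
  by rewrite inordK// ltnS -hl sorted_le_last.
have hs' : size (map (@inord N) s) == k by rewrite size_map hs.
by exists (Tuple hs') => //=; rewrite mem_enum inE /= sE ss hl eqxx.
Qed.

Section BaileyChain.
Variable C : numFieldType.
Variables (q t : C) (b c : nat -> C).

(** The kernel of Bailey's lemma for [a = t], [rho_1 = (b i)^-1] and [rho_2 = (c i)^-1], where
    [a q / (rho_1 rho_2)] is [b i * c i * t * q]. *)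
Definition bailey_step i M N : C :=
  qpoch (b i * c i * t * q) q (N - M)
  / (qpoch q q (N - M) * (qpoch (b i * t * q) q N * qpoch (c i * t * q) q N))
  * (qpoch (b i)^-1 q M * qpoch (c i)^-1 q M * (b i * c i) ^+ M * (t * q) ^+ M).

Fixpoint bailey_beta k N : C :=
  if k is k'.+1 then \sum_(M < N.+1) bailey_beta k' M * bailey_step k M N
  else (N == 0%N)%:R.

(** The factor before the product is [alpha_r] of the unit Bailey pair; each index [i] contributes
    one application of Bailey's lemma. *)
Definition bailey_alpha k r : C :=
  (-1) ^+ r * q ^+ 'C(r, 2) * (1 - t * q ^+ (2 * r)) * qpoch t q r
  / ((1 - t) * qpoch q q r)
  * \prod_(1 <= i < k.+1) (qpoch (b i)^-1 q r * qpoch (c i)^-1 q r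
      * (b i * c i * t * q) ^+ r / (qpoch (b i * t * q) q r * qpoch (c i * t * q) q r)).

(** This is [multisum_term] stripped of [t ^+ n_k] and of the inner sum in [z], which depend on
    [n_k] alone. *)
Definition chain_weight k (s : seq nat) : C :=
  let n i := nth 0%N (0%N :: s) i in
  t ^+ (\sum_(1 <= i < k) n i) * q ^+ (\sum_(1 <= i < k) n i)
  * (\prod_(1 <= i < k.+1)
       (qpoch (b i * c i * t * q) q (n i - n i.-1)
        / (qpoch q q (n i - n i.-1)
           * (qpoch (b i * t * q) q (n i) * qpoch (c i * t * q) q (n i)))))
  * (\prod_(1 <= i < k)
       (qpoch (b i.+1)^-1 q (n i) * qpoch (c i.+1)^-1 q (n i)
        * (b i.+1 * c i.+1) ^+ n i)).

Lemma chain_weight_rcons k s N : size s = k ->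
  chain_weight k.+1 (rcons s N) = chain_weight k s * bailey_step k.+1 (last 0%N s) N.
Proof.
move=> hs; rewrite /chain_weight /bailey_step.
have nE i : (i <= k)%N -> nth 0%N (0%N :: rcons s N) i = nth 0%N (0%N :: s) i.
  by move=> hi; rewrite -rcons_cons nth_rcons /= hs ltnS hi.
have nK : nth 0%N (0%N :: rcons s N) k.+1 = N by rewrite /= nth_rcons hs ltnn eqxx.
have nL : nth 0%N (0%N :: s) k = last 0%N s by rewrite -hs -[size s]/(size (0%N :: s)).-1 nth_last.
(* For the empty [s] the last entry defaults to [0 = n_0], where all powers and symbols in
   [bailey_step] indexed by it are [1]. *)
case: k hs nE nK nL => [|k] hs nE nK nL.
  move/size0nil: hs => -> /=; rewrite !big_nat1 !big_geq//= !qpoch0 subn0 !expr0.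
  by rewrite !(mulr1, mul1r).
rewrite (big_nat_recr k.+1) //= (big_nat_recr k.+2) //= [in X in _ * X]big_nat_recr //=.
have -> : nth 0%N (rcons s N) k = last 0%N s by rewrite -nL -nE.
have -> : nth 0%N (rcons s N) k.+1 = N by exact: nK.
rewrite (eq_big_nat _ _ (F2 := fun i => nth 0%N (0%N :: s) i)); last first.
  by move=> i /andP[_ hi]; rewrite nE// ltnW.
rewrite [X in _ * (X * _) * _](eq_big_nat _ _ (F2 := fun i =>
    qpoch (b i * c i * t * q) q (nth 0%N (0%N :: s) i - nth 0%N (0%N :: s) i.-1)
    / (qpoch q q (nth 0%N (0%N :: s) i - nth 0%N (0%N :: s) i.-1)
      * (qpoch (b i * t * q) q (nth 0%N (0%N :: s) i)
         * qpoch (c i * t * q) q (nth 0%N (0%N :: s) i))))); last first.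
  by move=> i /andP[_ hi]; rewrite !nE// (leq_trans (leq_pred _)).
rewrite [X in _ * (X * _) = _](eq_big_nat _ _ (F2 := fun i =>
    qpoch (b i.+1)^-1 q (nth 0%N (0%N :: s) i) * qpoch (c i.+1)^-1 q (nth 0%N (0%N :: s) i)
    * (b i.+1 * c i.+1) ^+ nth 0%N (0%N :: s) i)); last first.
  by move=> i /andP[_ hi]; rewrite !nE// ltnW.
rewrite !exprD (exprMn _ t q).
set P1 := \prod_(1 <= i < k.+2) _; set P2 := \prod_(1 <= i < k.+1) _.
set A1 := _ / _; ring.
Qed.

Lemma chain_weight_sum k N : \sum_(s <- chain_seqs k N) chain_weight k s = bailey_beta k N.
Proof.
elim: k N => [|k IH] N.
  case: N => [|N] /=; last by rewrite big_nil.
  by rewrite big_cons big_nil /chain_weight !big_geq// !expr0 !mulr1 addr0.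
rewrite chain_seqsS (@big_allpairs_dep _ _ _ nat (fun=> seq nat)) big_mkord /=.
apply: eq_bigr => M _; rewrite -IH mulr_suml; apply: eq_big_seq => s.
rewrite mem_chain_seqs => /and3P[/eqP hs _ /eqP hl].
by rewrite chain_weight_rcons// hl.
Qed.

Lemma multisum_levelE k z N : multisum_level k q t z b c N =
  bailey_beta k N * (t ^+ N *
    \sum_(j < (2 * N).+1) qbinom q (2 * N) j * z ^ ((2 * j)%:Z - (2 * N)%:Z)).
Proof.
rewrite /multisum_level (big_chains _ _ _ (multisum_term k q t z b c)).
rewrite -chain_weight_sum mulr_suml; apply: eq_big_seq => s.
rewrite mem_chain_seqs => /and3P[/eqP hs _ /eqP hl].
have nL : nth 0%N (0%N :: s) k = N.
  by rewrite -hl -hs -[size s]/(size (0%N :: s)).-1 nth_last.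
rewrite /multisum_term /chain_weight nL.
have -> : (\sum_(1 <= i < k.+1) nth 0 (0 :: s) i = \sum_(1 <= i < k) nth 0 (0 :: s) i + N)%N.
  case: k hs nL => [|k] hs nL; last by rewrite big_nat_recr //= -nL.
  by rewrite !big_geq// -nL.
rewrite exprD; set S := \sum_(_ < _) _.
set P1 := \prod_(1 <= i < k.+1) _; set P2 := \prod_(1 <= i < k) _; ring.
Qed.

Hypothesis q_nz : forall n, qpoch q q n != 0.
Hypothesis t_nz : forall n, qpoch t q n != 0.

Let tq_nz n : qpoch (t * q) q n != 0.
Proof. by have := t_nz n.+1; rewrite qpochSl mulf_eq0 negb_or => /andP[]. Qed.

(** Induction on [k] from the unit Bailey pair: after expanding the previous [bailey_beta] and
    summing over [r] outside, with [M = r + i], the inner sum is a q-Saalschutz sum. *)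
Lemma bailey_chain k N :
  (forall i, (1 <= i <= k)%N -> b i != 0 /\ c i != 0) ->
  (forall i n, (1 <= i <= k)%N ->
     qpoch (b i * t * q) q n != 0 /\ qpoch (c i * t * q) q n != 0) ->
  bailey_beta k N =
  \sum_(r < N.+1) bailey_alpha k r / (qpoch q q (N - r) * qpoch (t * q) q (N + r)).
Proof.
elim: k N => [|k IH] N bc0 bcq /=.
  rewrite -(unit_bailey_pair _ _ _ N q_nz t_nz); apply: eq_bigr => r _.
  by rewrite /bailey_alpha big_geq// mulr1.
have [b0 c0] := bc0 k.+1 (leqnn _); have bcqk n := bcq k.+1 n (leqnn _).
have w i : (0 < i <= k)%N -> (0 < i <= k.+1)%N by move=> /andP[-> /leqW ->].
have {}IH M := IH M (fun i hi => bc0 i (w i hi)) (fun i n hi => bcq i n (w i hi)).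
pose f r m := bailey_alpha k r / (qpoch q q m * qpoch (t * q) q (r + r + m))
  * bailey_step k.+1 (r + m) N.
rewrite (eq_bigr (fun M : 'I_N.+1 => \sum_(r < M.+1) f r (M - r)%N)); last first.
  move=> M _; rewrite IH mulr_suml; apply: eq_bigr => r _.
  have rM : (r <= M)%N by rewrite -ltnS.
  by rewrite /f subnKC// -addnA subnKC// [(r + M)%N]addnC.
rewrite (sum_triangle _ f); apply: eq_bigr => -[r rN] _ /=; rewrite ltnS in rN.
rewrite subSn//; set m := (N - r)%N; have NE : N = (r + m)%N by rewrite subnKC.
have NrE : (N + r = r + r + m)%N by rewrite NE addnAC.
(* With these values [u X], [u Y] and [u X Y] are [c t q^(r+1)], [b t q^(r+1)] and [t q^(2r+1)]; the
   numerators of the evaluation cut [(c t q; q)_N] and [(b t q; q)_N] down to length [r]. *)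
pose u := b k.+1 * c k.+1 * t * q.
pose X := (b k.+1)^-1 * q ^+ r; pose Y := (c k.+1)^-1 * q ^+ r.
have uX : u * X = c k.+1 * t * q * q ^+ r by rewrite /u /X; field.
have uY : u * Y = b k.+1 * t * q * q ^+ r by rewrite /u /Y; field.
have uXY : u * X * Y = t * q * q ^+ (r + r).
  by rewrite uX /Y exprD; field.
have A_nz n : qpoch (u * X * Y) q n != 0.
  by have := tq_nz (r + r + n); rewrite qpochD uXY mulf_eq0 negb_or => /andP[].
have uE n : u ^+ n = (b k.+1 * c k.+1) ^+ n * (t * q) ^+ n by rewrite -exprMn mulrA.
have sa := q_saalschutz C q u X Y q_nz A_nz m.
rewrite (eq_bigr (fun i : 'I_m.+1 => bailey_alpha k r / qpoch (t * q) q (r + r)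
   * (qpoch (b k.+1)^-1 q r * qpoch (c k.+1)^-1 q r * u ^+ r)
   / (qpoch (b k.+1 * t * q) q N * qpoch (c k.+1 * t * q) q N)
   * (qpoch u q (m - i) * qpoch X q i * qpoch Y q i * u ^+ i
      / (qpoch q q (m - i) * qpoch q q i * qpoch (u * X * Y) q i)))); last first.
  move=> i _; have im : (i <= m)%N by rewrite -ltnS.
  rewrite /f /bailey_step subnDA -/m (qpochD _ _ (r + r)) -uXY.
  rewrite (qpochD (b k.+1)^-1) (qpochD (c k.+1)^-1) -/X -/Y -/u.
  rewrite !uE !exprD !invfM; ring.
rewrite -mulr_sumr sa NrE (qpochD (t * q) q (r + r)) -uXY.
rewrite /bailey_alpha (big_nat_recr k.+1) //= -/u.
rewrite NE (qpochD (b k.+1 * t * q)) (qpochD (c k.+1 * t * q)) -uX -uY.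
have [] := bcqk r; have [] := bcqk N; rewrite NE !qpochD !mulf_eq0 !negb_or -uX -uY.
move=> /andP[_ h1] /andP[_ h2] h3 h4; have := q_nz m; have := A_nz m; have := tq_nz (r + r).
rewrite qpochD mulf_eq0 negb_or => /andP[h5 h8] h6 h7.
set A1 := _ / ((1 - t) * _); set A2 := \prod_(1 <= i < k.+1) _.
by field; rewrite h1 h2 h3 h4 h5 h6 h7 h8.
Qed.

End BaileyChain.

(** * The conjugate Bailey pair *)

Section Convolution.
Variable C : comPzRingType.
Implicit Types (x y : nat -> C).

(** Sequences stand for power series: [conv] is the product, [shift] is multiplication by the
    variable, and [q ^+ j * x j] is the dilation of the variable by [q]. *)
Definition conv x y n : C := \sum_(j < n.+1) x j * y (n - j)%N.

Definition shift x n : C := if n is n'.+1 then x n' else 0.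

Lemma conv_shiftl x y n : conv (shift x) y n = shift (conv x y) n.
Proof.
case: n => [|n]; first by rewrite /conv big_ord_recl big_ord0 mul0r addr0.
by rewrite /conv big_ord_recl mul0r add0r.
Qed.

Lemma conv_shiftr x y n : conv x (shift y) n = shift (conv x y) n.
Proof.
case: n => [|n]; first by rewrite /conv big_ord_recl big_ord0 mulr0 addr0.
rewrite /conv big_ord_recr /= subnn mulr0 addr0; apply: eq_bigr => j _.
by rewrite subSn// -ltnS.
Qed.

Lemma conv_bilin x x' y y' a b n :
  conv (fun j => x j - a * x' j) (fun j => y j - b * y' j) n
  = conv x y n - b * conv x y' n - a * conv x' y n + a * b * conv x' y' n.
Proof.
rewrite !mulr_sumr -!sumrB -big_split /=; apply: eq_bigr => j _; ring.
Qed.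

Lemma conv_dilate x y q n :
  conv (fun j => q ^+ j * x j) (fun j => q ^+ j * y j) n = q ^+ n * conv x y n.
Proof.
rewrite mulr_sumr; apply: eq_bigr => j _.
by rewrite mulrACA -exprD subnKC// -ltnS.
Qed.

(* If [X] and [Y] are the generating functions of [x] and [y], this says that
   [(1 - z s) X s = (1 - t z s) X (q s)] and [(1 - w s) Y s = (1 - t w s) Y (q s)]
   imply [(1 - z s) (1 - w s) X s Y s = (1 - t z s) (1 - t w s) X (q s) Y (q s)]. *)
Lemma conv_qdiff x y q t z w n :
  (forall j, x j - z * shift x j = q ^+ j * x j - t * z * shift (fun i => q ^+ i * x i) j) ->
  (forall j, y j - w * shift y j = q ^+ j * y j - t * w * shift (fun i => q ^+ i * y i) j) ->
  let P := conv x y in let Q := fun i => q ^+ i * conv x y i in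
  P n - (z + w) * shift P n + z * w * shift (shift P) n
  = Q n - t * (z + w) * shift Q n + t ^+ 2 * (z * w) * shift (shift Q) n.
Proof.
move=> hx hy P Q.
have : conv (fun j => x j - z * shift x j) (fun j => y j - w * shift y j) n
     = conv (fun j => q ^+ j * x j - t * z * shift (fun i => q ^+ i * x i) j)
            (fun j => q ^+ j * y j - t * w * shift (fun i => q ^+ i * y i) j) n.
  by apply: eq_bigr => j _; rewrite hx hy.
rewrite !conv_bilin.
have QE : conv (fun i => q ^+ i * x i) (fun i => q ^+ i * y i) =1 Q.
  by move=> i; rewrite conv_dilate.
have sE (f g : nat -> C) : f =1 g -> shift f =1 shift g by move=> fg [|i] //=.
rewrite !conv_shiftl !conv_shiftr !(sE _ _ (conv_shiftr _ _)) -/P !(sE _ _ QE) QE.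
rewrite !(sE _ _ (sE _ _ QE)) => h.
apply: subr0_eq; move/eqP: h; rewrite -subr_eq0 => /eqP h; rewrite -[RHS]h; ring.
Qed.

End Convolution.

Arguments conv {C}.
Arguments shift {C}.

(** * Continuous q-ultraspherical and q-Hermite polynomials *)

Section RogersPolynomials.
Variable C : numFieldType.
Variables (q z : C).
Hypothesis q_nz : forall n, qpoch q q n != 0.
Hypothesis z0 : z != 0.

(* The continuous q-ultraspherical polynomials of parameter [t], at
   [(z + z^-1) / 2]; the case [t = 0] gives the continuous q-Hermite
   polynomials divided by [(q; q)_n]. *)
Definition rogers (t : C) n : C :=
  \sum_(j < n.+1) qpoch t q j * qpoch t q (n - j) * z ^ ((2 * j)%:Z - n%:Z)
    / (qpoch q q j * qpoch q q (n - j)).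

Definition qhermite n : C :=
  \sum_(j < n.+1) qbinom q n j * z ^ ((2 * j)%:Z - n%:Z).

Lemma exprz_sub2 j n : (j <= n)%N ->
  z ^ ((2 * j)%:Z - n%:Z) = z ^+ j * (z^-1) ^+ (n - j).
Proof.
move=> jn; rewrite -{1}(subnKC jn) mul2n -addnn !PoszD opprD addrACA subrr add0r.
by rewrite expfzDr// -invr_expz exprVn.
Qed.

Lemma rogers_conv t n : rogers t n =
  conv (fun j => qpoch t q j / qpoch q q j * z ^+ j)
       (fun j => qpoch t q j / qpoch q q j * z^-1 ^+ j) n.
Proof.
apply: eq_bigr => j _; have jn : (j <= n)%N by rewrite -ltnS.
by rewrite exprz_sub2// invfM; ring.
Qed.

(** The coefficients [(t; q)_j / (q; q)_j * w ^+ j] satisfy the q-binomial difference equation for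
    [w = z] and [w = z^-1]; order [n.+1] of [conv_qdiff] is the recurrence. At [n = 0] the truncated
    [n.-1] is harmless since [shift] gives [0]. *)
Lemma rogers_rec t n : (1 - q ^+ n.+1) * rogers t n.+1
  = (z + z^-1) * (1 - t * q ^+ n) * rogers t n
    - (1 - t ^+ 2 * q ^+ n.-1) * shift (rogers t) n.
Proof.
pose co w j := qpoch t q j / qpoch q q j * w ^+ j.
have key w j : co w j - w * shift (co w) j
             = q ^+ j * co w j - t * w * shift (fun i => q ^+ i * co w i) j.
  case: j => [|j]; first by rewrite /= !mulr0 expr0 mul1r.
  rewrite /co /= (qpochS t) (qpochS q) !exprS.
  have := q_nz j; have := qpoch_neq0S q q j q_nz => h1 h2.
  by field; rewrite h1 h2.
have h := conv_qdiff C (co z) (co z^-1) q t z z^-1 n.+1 (key z) (key z^-1).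
have eR m : conv (co z) (co z^-1) m = rogers t m by rewrite rogers_conv.
case: n h => [|n] /=; rewrite !eR => h; apply: subr0_eq; move/eqP: h.
  by rewrite -subr_eq0 => /eqP h; rewrite -[RHS]h !expr0; ring.
by rewrite -subr_eq0 => /eqP h; rewrite -[RHS]h !exprS; field.
Qed.

Lemma qhermiteE n : qhermite n = qpoch q q n * rogers 0 n.
Proof.
rewrite /qhermite /rogers mulr_sumr; apply: eq_bigr => j _.
have h0 m : qpoch 0 q m = 1.
  by apply: big1 => i _; rewrite mul0r subr0.
by rewrite /qbinom -ltnS ltn_ord !h0; ring.
Qed.

Lemma qhermite0 : qhermite 0 = 1.
Proof.
by rewrite /qhermite big_ord_recl big_ord0 /qbinom /= !qpoch0 subrr expr0z addr0 !mulr1 divr1.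
Qed.

Lemma qhermite_rec n : qhermite n.+1
  = (z + z^-1) * qhermite n - (1 - q ^+ n) * shift qhermite n.
Proof.
rewrite qhermiteE qpochS -exprS -mulrA rogers_rec mul0r subr0 mulr1.
rewrite expr0n /= mul0r subr0 mul1r.
case: n => [|n] /=; first by rewrite expr0 subrr mul0r !qhermiteE; ring.
by rewrite !qhermiteE (qpochS q q n) -exprS; ring.
Qed.

End RogersPolynomials.

(** * Truncated identities for the conjugate sums *)

Section Telescoping.
Variable C : numFieldType.
Variables (q z : C).
Hypothesis q_nz : forall n, qpoch q q n != 0.
Hypothesis z0 : z != 0.

Local Notation H := (qhermite C q z).

Definition conj_term (t : C) M m : C :=
  t ^+ m * H (M + 2 * m)%N / (qpoch q q m * qpoch t q (M + m).+1).

Lemma qhermite_rec_pred n : H n.+1 = (z + z^-1) * H n - (1 - q ^+ n) * H n.-1.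
Proof.
rewrite qhermite_rec//; case: n => [|n] //=.
by rewrite expr0 subrr !mul0r.
Qed.

(** Induction on the truncation [L]: the right side is the boundary term, whose increment follows
    from the q-Hermite recurrence. At [M = 0] the factor [1 - q ^+ M] annihilates the sum with index
    [M.-1]. *)
Lemma conj_term_rec t M L : (forall n, qpoch t q n != 0) ->
  (1 - t ^+ 2 * q ^+ M) * (\sum_(m < L) conj_term t M.+1 m)
  - (z + z^-1) * (1 - t * q ^+ M) * (\sum_(m < L) conj_term t M m)
  + (1 - q ^+ M) * (\sum_(m < L) conj_term t M.-1 m)
  = q ^+ M * t ^+ L * (1 - q ^+ L) * (1 + q ^+ L - t - t * q ^+ (M + L))
    / (qpoch q q L * qpoch t q (M + L).+1) * H (M + 2 * L).-1.
Proof.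
move=> t_nz; elim: L => [|L IH].
  by rewrite !big_ord0 !mulr0 subr0 addr0 expr0 subrr !(mulr0, mul0r).
rewrite !big_ord_recr /=; move: IH.
move: (\sum_(m < L) conj_term t M.+1 m) (\sum_(m < L) conj_term t M m).
move: (\sum_(m < L) conj_term t M.-1 m) => S0 S2 S1 IH.
have addE (a1 a2 a3 u v w u' v' w' : C) : a1 * (u + u') - a2 * (v + v') + a3 * (w + w')
  = a1 * u - a2 * v + a3 * w + (a1 * u' - a2 * v' + a3 * w') by ring.
rewrite addE IH.
have pE : (1 - q ^+ M) * conj_term t M.-1 L =
    (1 - q ^+ M) * (t ^+ L * H (M + 2 * L).-1 / (qpoch q q L * qpoch t q (M + L))).
  by case: M {IH} => [|M]; [rewrite expr0 subrr !mul0r | rewrite /conj_term addSn].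
rewrite pE /conj_term.
have -> : (M + 2 * L.+1).-1 = (M + 2 * L).+1 by rewrite mulnS addnCA.
rewrite !addSn addnS (qhermite_rec_pred (M + 2 * L)) !(qpochS t) (qpochS q).
have := q_nz L; have := qpoch_neq0S q q L q_nz.
have := t_nz (M + L)%N; have := qpoch_neq0S t q (M + L) t_nz.
have := qpoch_neq0S t q (M + L).+1 t_nz.
rewrite !exprS mul2n -addnn !exprD.
move: (H (M + (L + L)).-1) (H (M + (L + L))%N) (qpoch q q L) (qpoch t q (M + L)).
move: (q ^+ M) (q ^+ L) (t ^+ L) => QM p tL H0 H1 Q T h1 h2 h3 h4 h5.
by field; rewrite h1 h2 h3 h4 h5 z0.
Qed.

(** Again a telescoping induction on [L], now between the parameters [t] and [t * q]; the boundary
    terms contain a power of [t] times a q-Hermite polynomial, hence vanish in the limit for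
    suitable [t]. *)
Lemma conj_term0_qdiff t L : (forall n, qpoch t q n != 0) ->
  (1 - t) ^+ 2 * (1 - t * z ^+ 2) * (1 - t * z ^- 2) * (\sum_(m < L.+1) conj_term t 0 m)
  - (1 - t ^+ 2) * (1 - t ^+ 2 * q) * (\sum_(m < L.+1) conj_term (t * q) 0 m)
  = - (1 - t) ^+ 2 * (t ^+ L.+1 * H (2 * L.+1)%N) / (qpoch q q L * qpoch t q L.+1)
    + (1 - t) ^+ 2 * t ^+ 2 * (t ^+ L * H (2 * L)%N)
      * (1 - q ^+ (2 * L).+2) * (1 - q ^+ (2 * L).+1) / (qpoch q q L.+1 * qpoch t q L.+2).
Proof.
move=> t_nz.
have t1 : 1 - t != 0 by have := qpoch_neq0S t q 0 t_nz; rewrite expr0 mulr1.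
have tqE n : qpoch (t * q) q n = qpoch t q n.+1 / (1 - t).
  by rewrite qpochSl [RHS]mulrC mulKf.
elim: L => [|L IH].
  rewrite !big_ord_recr !big_ord0 /= /conj_term !tqE !addn0 !muln0 !muln1.
  rewrite (qhermite_rec_pred 1) (qhermite_rec_pred 0) qhermite0 !qpochS !qpoch0 !expr0 !expr1.
  have := qpoch_neq0S t q 1 t_nz; have := qpoch_neq0S q q 0 q_nz.
  rewrite expr1 expr0 mulr1 !mul1r => h1 h2.
  by field; rewrite h1 h2 z0 t1.
rewrite big_ord_recr [X in _ - _ * X]big_ord_recr /= mulrDr [X in _ - X]mulrDr opprD addrACA IH.
rewrite /conj_term.
rewrite !tqE !add0n.
have -> : (2 * L.+2 = (2 * L).+4)%N by rewrite !mulnS.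
have -> : (2 * L.+1 = (2 * L).+2)%N by rewrite !mulnS.
(* Three uses of the recurrence leave only [H] at [2L] and [2L + 1]. *)
rewrite (qhermite_rec_pred (2 * L).+3) (qhermite_rec_pred (2 * L).+2).
rewrite (qhermite_rec_pred (2 * L).+1) /= !(qpochS t) !(qpochS q) exprMn.
have := q_nz L; have := qpoch_neq0S q q L q_nz; have := qpoch_neq0S q q L.+1 q_nz.
have := t_nz L; have := qpoch_neq0S t q L t_nz.
have := qpoch_neq0S t q L.+1 t_nz; have := qpoch_neq0S t q L.+2 t_nz.
rewrite mul2n -addnn !exprS !exprD !expr0.
move: (H (L + L).+1) (H (L + L)%N) (qpoch q q L) (qpoch t q L).
move: (q ^+ L) (t ^+ L) => p tL H1 H0 Q T h1 h2 h3 h4 h5 h6 h7.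
by field; rewrite h1 h2 h3 h4 h5 h6 h7 z0 t1.
Qed.

End Telescoping.

(** * Evaluation of the conjugate sums *)

Section ConjugateBaileyPair.
Variable R : realType.
Local Notation C := (cplx R).
Variables (q z : C).
Hypothesis q1 : `|q| < 1.
Hypothesis z0 : z != 0.

Local Notation H := (qhermite C q z).

Lemma qpoch_lt1_neq0 (a : C) n : `|a| < 1 -> qpoch a q n != 0.
Proof.
move=> a1; apply: qpoch_neq0 => i; apply/eqP => h.
suff : `|a * q ^+ i| < 1 by rewrite h normr1 ltxx.
rewrite normrM normrX (le_lt_trans _ a1)// ler_piMr// exprn_ile1// ltW//.
Qed.

Let q_nz n : qpoch q q n != 0. Proof. exact: qpoch_lt1_neq0. Qed.

(** The q-binomial coefficients are uniformly bounded, and each of the [n.+1] monomials has norm at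
    most [y ^+ n]. *)
Lemma qhermite_bound : exists2 K : C, 0 <= K & forall y n, `|z| <= y -> `|z^-1| <= y ->
  `|H n| <= K * n.+1%:R * y ^+ n.
Proof.
have [K K0 hK] := bnd_qpoch _ q q q1; have [L L0 hL] := bnd_qpochV _ q q q1.
exists (K * (L * L)) => [|y n zy zVy]; first by rewrite !mulr_ge0.
have y0 : 0 <= y by exact: le_trans zy.
apply: le_trans (ler_norm_sum _ _ _) _.
have -> : K * (L * L) * n.+1%:R * y ^+ n = \sum_(j < n.+1) K * (L * L) * y ^+ n.
  by rewrite sumr_const card_ord mulrAC mulr_natr.
apply: ler_sum => j _; have jn : (j <= n)%N by rewrite -ltnS.
rewrite exprz_sub2// /qbinom jn invfM normrM; apply: ler_pM => //.
  by rewrite normrM; apply: ler_pM => //; rewrite normrM; apply: ler_pM.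
rewrite -[in leRHS](subnKC jn) exprD normrM !normrX; apply: ler_pM; rewrite ?exprn_ge0//.
  by rewrite lerXn2r ?nnegrE.
by rewrite lerXn2r ?nnegrE.
Qed.

(** For [z != 0] this says [|t| * y ^+ 2 < 1] with [y] the larger of [|z|] and [|z|^-1], which makes
    [t ^+ m * H (2 * m)] decay geometrically. *)
Definition admissible (t : C) := [/\ `|t| < 1, `|t * z ^+ 2| < 1 & `|t * z ^- 2| < 1].

Lemma admissibleM t n : admissible t -> admissible (t * q ^+ n).
Proof.
have le1 (x : C) : `|x| < 1 -> `|x * q ^+ n| < 1.
  move=> x1; rewrite normrM normrX (le_lt_trans _ x1)// ler_piMr// exprn_ile1// ltW//.
by move=> [/le1 h1 /le1 h2 /le1 h3]; split; rewrite // mulrAC.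
Qed.

Lemma expr_qhermite_bound t : admissible t -> exists y K r : C,
  [/\ 1 <= y, 0 <= K, 0 <= r, r < 1 & forall M m,
   `|t ^+ m * H (M + 2 * m)| <= K * M.+2%:R * y ^+ M * r ^+ m].
Proof.
move=> [t1 tz tzV].
have [y [y1 zy zVy ty]] : exists y : C, [/\ 1 <= y, `|z| <= y, `|z^-1| <= y & `|t| * y ^+ 2 < 1].
  have [z1|z1] := real_leP (@real1 C) (normr_real z).
    exists `|z|; split=> //; last by rewrite -normrX -normrM.
    by rewrite normfV (le_trans _ z1)// invf_le1// (lt_le_trans _ z1).
  exists `|z|^-1; have nz0 : 0 < `|z| by rewrite normr_gt0.
  have zV1 : 1 <= `|z|^-1 by rewrite invf_ge1// ltW.
  split=> //; [exact: le_trans (ltW z1) zV1|by rewrite normfV|].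
  by rewrite exprVn -normrX -normfV -normrM.
have y0 : 0 <= y by exact: le_trans y1.
have [K K0 hK] := qhermite_bound.
have ty0 : 0 <= `|t| * y ^+ 2 by rewrite mulr_ge0// exprn_ge0.
have [L [r [L0 r0 r1 hL]]] := natr_expr_le _ _ ty0 ty.
exists y, (K * L), r; split=> //; first exact: mulr_ge0.
move=> M m; rewrite normrM normrX.
(* The bound [M + 2m + 1 <= (M + 2)(m + 1)] separates the two indices, and [natr_expr_le] absorbs
   [m + 1]. *)
apply: (@le_trans _ _ (`|t| ^+ m * (K * (M.+2%:R * m.+1%:R) * y ^+ (M + 2 * m)))).
  rewrite ler_wpM2l ?exprn_ge0//; apply: le_trans (hK y _ zy zVy) _.
  rewrite ler_wpM2r ?exprn_ge0// ler_wpM2l// -natrM ler_nat.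
  rewrite (_ : M.+2 * m.+1 = M * m.+1 + (m.+1 + m.+1))%N; last by rewrite !mulSn addnA addnC.
  rewrite -addnS; apply: leq_add; first exact: leq_pmulr.
  by rewrite mul2n -addnn addSn addnS.
have rE (a b c d e f : C) : a * (b * (c * d) * (e * f)) = b * c * e * (d * (a * f)) by ring.
rewrite exprD exprM rE -exprMn.
have -> : K * L * M.+2%:R * y ^+ M * r ^+ m = K * M.+2%:R * y ^+ M * (L * r ^+ m).
  by rewrite !mulrA (mulrAC K L) (mulrAC _ L).
by rewrite ler_wpM2l// !mulr_ge0 ?exprn_ge0.
Qed.

Lemma geo_expr_qhermite t M : admissible t -> geo R (fun m => t ^+ m * H (M + 2 * m)%N).
Proof.
move=> /expr_qhermite_bound[y [K [r [y1 K0 r0 r1 h]]]].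
exists (K * M.+2%:R * y ^+ M), r; split=> //.
by rewrite !mulr_ge0// exprn_ge0// (le_trans _ y1).
Qed.

Lemma geo_conj_term t M : admissible t -> geo R (conj_term C q z t M).
Proof.
move=> ht; apply: geoM; first exact: geo_expr_qhermite.
apply: (eq_bnd _ _ (fun m => (qpoch q q m)^-1 * (qpoch t q (M + m).+1)^-1)).
  by move=> m; rewrite invfM.
apply: bndM; first exact: bnd_qpochV.
have [L L0 hL] := bnd_qpochV _ t q q1; by exists L.
Qed.

Definition conj_sum t M : C := limn (series (conj_term C q z t M)).

Lemma cvg_conj_sum t M : admissible t ->
  (fun L => \sum_(m < L) conj_term C q z t M m) @ \oo --> conj_sum t M.
Proof.
by move=> ht; have := geo_is_cvg_series _ _ (geo_conj_term t M ht); rewrite /conj_sum seriesEord.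
Qed.

Lemma cvg_uniq (u : nat -> C) (l l' : C) : u @ \oo --> l -> u @ \oo --> l' -> l = l'.
Proof. by move=> /(@cvg_lim C (@norm_hausdorff _ _)) <- /(@cvg_lim C (@norm_hausdorff _ _)) <-. Qed.

(** Limit of [conj_term_rec], whose boundary term is a geometrically small sequence times a bounded
    one. *)
Lemma conj_sum_rec t M : admissible t ->
  (1 - t ^+ 2 * q ^+ M) * conj_sum t M.+1
  = (z + z^-1) * (1 - t * q ^+ M) * conj_sum t M - (1 - q ^+ M) * conj_sum t M.-1.
Proof.
move=> ht; have [t1 _ _] := ht.
have t_nz n : qpoch t q n != 0 by exact: qpoch_lt1_neq0.
apply/eqP; rewrite -subr_eq0 opprB addrA addrAC; apply/eqP.
apply: cvg_uniq.
  apply: (@cvgD C C); first apply: (@cvgB C C).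
  - by apply: (@cvgM C); [exact: cvg_cst | exact: cvg_conj_sum].
  - by apply: (@cvgM C); [exact: cvg_cst | exact: cvg_conj_sum].
  - by apply: (@cvgM C); [exact: cvg_cst | exact: cvg_conj_sum].
(* At truncation [L.+1] the index [(M + 2 * L.+1).-1] is [M.+1 + 2 * L], so that [geo_expr_qhermite]
   applies. *)
rewrite -cvg_shiftS.
pose w L := q ^+ M * t * (1 - q ^+ L.+1) * (1 + q ^+ L.+1 - t - t * q ^+ (M + L.+1))
  * (qpoch q q L.+1)^-1 * (qpoch t q (M + L.+1).+1)^-1.
rewrite (_ : [sequence _]_n = fun L => t ^+ L * H (M.+1 + 2 * L)%N * w L).
  apply/geo_cvg0/geoM; first exact: geo_expr_qhermite.
  have bq g : bnd R (fun L => q ^+ g L).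
    by apply: (bnd_comp _ (fun n => q ^+ n)); apply: bnd_expr; exact: ltW.
  have bV (a : C) g : bnd R (fun L => (qpoch a q (g L))^-1).
    by apply: (bnd_comp _ (fun n => (qpoch a q n)^-1)); exact: bnd_qpochV.
  rewrite /w; do 2![apply: bndM => //]; apply: bndM; first apply: bndM.
  - exact: bnd_cst.
  - by apply: bndB => //; exact: bnd_cst.
  - apply: bndB; first apply: bndB; first apply: bndD => //; try exact: bnd_cst.
    by apply: bndM => //; exact: bnd_cst.
apply/funext => L; transitivity (q ^+ M * t ^+ L.+1 * (1 - q ^+ L.+1)
  * (1 + q ^+ L.+1 - t - t * q ^+ (M + L.+1)) / (qpoch q q L.+1 * qpoch t q (M + L.+1).+1)
  * H (M + 2 * L.+1).-1); first exact: (conj_term_rec C q z q_nz z0 t M L.+1 t_nz).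
have -> : (M + 2 * L.+1).-1 = (M.+1 + 2 * L)%N by rewrite mulnS addnCA.
rewrite /w invfM (exprS t); ring.
Qed.

Lemma conj_sum0_qdiff t : admissible t ->
  (1 - t) ^+ 2 * (1 - t * z ^+ 2) * (1 - t * z ^- 2) * conj_sum t 0
  = (1 - t ^+ 2) * (1 - t ^+ 2 * q) * conj_sum (t * q) 0.
Proof.
move=> ht; have [t1 _ _] := ht.
have t_nz n : qpoch t q n != 0 by exact: qpoch_lt1_neq0.
have htq : admissible (t * q) by have := admissibleM t 1 ht; rewrite expr1.
apply/eqP; rewrite -subr_eq0; apply/eqP.
apply: cvg_uniq.
  apply: (@cvgB C C).
  - by apply: (@cvgM C); [exact: cvg_cst | exact: cvg_conj_sum].
  - by apply: (@cvgM C); [exact: cvg_cst | exact: cvg_conj_sum].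
rewrite -cvg_shiftS.
have bq g : bnd R (fun L => q ^+ g L).
  by apply: (bnd_comp _ (fun n => q ^+ n)); apply: bnd_expr; exact: ltW.
have bV (a : C) g : bnd R (fun L => (qpoch a q (g L))^-1).
  by apply: (bnd_comp _ (fun n => (qpoch a q n)^-1)); exact: bnd_qpochV.
pose w1 L := - (1 - t) ^+ 2 * (qpoch q q L)^-1 * (qpoch t q L.+1)^-1.
pose w2 L := (1 - t) ^+ 2 * t ^+ 2 * (1 - q ^+ (2 * L).+2) * (1 - q ^+ (2 * L).+1)
  * (qpoch q q L.+1)^-1 * (qpoch t q L.+2)^-1.
have g1 := geo_expr_qhermite t 0 ht.
rewrite (_ : [sequence _]_n = fun L =>
  (t ^+ L.+1 * H (0 + 2 * L.+1)%N * w1 L) + (t ^+ L * H (0 + 2 * L)%N * w2 L)).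
  have := @cvgD C C nat \oo _ (fun L => t ^+ L.+1 * H (0 + 2 * L.+1)%N * w1 L)
    (fun L => t ^+ L * H (0 + 2 * L)%N * w2 L) 0 0.
  rewrite addr0; apply; apply/geo_cvg0/geoM => //.
  - exact: geo_shift _ _ g1.
  - by do 2![apply: bndM => //]; exact: bnd_cst.
  - rewrite /w2; do 2![apply: bndM => //]; apply: bndM; first apply: bndM.
    + exact: bnd_cst.
    + by apply: bndB => //; exact: bnd_cst.
    + by apply: bndB => //; exact: bnd_cst.
apply/funext => L; apply: etrans (conj_term0_qdiff C q z q_nz z0 t L t_nz) _.
by rewrite /w1 /w2 !add0n; congr (_ + _); rewrite !invfM; ring.
Qed.

(** Each use of [conj_sum0_qdiff], at [t * q ^+ n], contributes two consecutive factors of the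
    symbol in [t ^+ 2], whence its length [2 * n]. *)
Lemma conj_sum0_iter t n : admissible t ->
  conj_sum t 0 * (qpoch t q n ^+ 2 * qpoch (t * z ^+ 2) q n * qpoch (t * z ^- 2) q n)
  = qpoch (t ^+ 2) q (2 * n) * conj_sum (t * q ^+ n) 0.
Proof.
move=> ht; elim: n => [|n IH].
  by rewrite muln0 !qpoch0 expr0 expr1n !mulr1 mul1r.
have h := conj_sum0_qdiff _ (admissibleM t n ht).
have tE : t * q ^+ n.+1 = t * q ^+ n * q by rewrite exprSr mulrA.
rewrite mulnS !qpochS tE.
transitivity (conj_sum t 0 * (qpoch t q n ^+ 2 * qpoch (t * z ^+ 2) q n * qpoch (t * z ^- 2) q n)
  * ((1 - t * q ^+ n) ^+ 2 * (1 - t * q ^+ n * z ^+ 2) * (1 - t * q ^+ n * z ^- 2))).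
  ring.
have mE (x y v : C) : x * y * v = x * (v * y) by ring.
rewrite IH [LHS]mE h mul2n -addnn !exprS !exprD expr0; ring.
Qed.

(** The term [m = 0] is [(1 - t * q ^+ n)^-1], and the terms with [m >= 1] carry [q ^+ (n * m)]; the
    total error is of order [|q| ^+ n]. *)
Lemma cvg_conj_sum0 t : admissible t -> (fun n => conj_sum (t * q ^+ n) 0) @ \oo --> (1 : C).
Proof.
move=> ht; have [t1 _ _] := ht.
have t_nz n : qpoch t q n != 0 by exact: qpoch_lt1_neq0.
have [y [K [r [_ K0 r0 r1 hH]]]] := expr_qhermite_bound t ht.
have [L L0 hL] := bnd_qpochV _ q q q1.
(* A bound uniform in [n] too, because [(t q^n; q)_m = (t; q)_(n+m) / (t; q)_n]. *)
have [B B0 hB] : exists2 B : C, 0 <= B & forall n m, `|(qpoch (t * q ^+ n) q m)^-1| <= B.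
  have [B1 B10 hB1] := bnd_qpoch _ t q q1; have [B2 B20 hB2] := bnd_qpochV _ t q q1.
  exists (B1 * B2) => [|n m]; first exact: mulr_ge0.
  have -> : (qpoch (t * q ^+ n) q m)^-1 = qpoch t q n * (qpoch t q (n + m))^-1.
    by rewrite qpochD invfM mulVKf.
  by rewrite normrM ler_pM.
pose K1 := K * 2%:R * (L * B).
have K10 : 0 <= K1 by rewrite !mulr_ge0.
apply: (le_expr_cvg _ _ _ (K1 / (1 - r) + B) `|q|) => // n.
have tq1 : 1 - t * q ^+ n != 0 by exact: qpoch_neq0S.
have qn1 : `|q| ^+ n <= 1 by rewrite exprn_ile1// ltW.
have qr0 : 0 <= `|q| ^+ n * r by rewrite mulr_ge0// exprn_ge0.
have qrr : `|q| ^+ n * r <= r by rewrite ler_piMl.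
have qr1 : `|q| ^+ n * r < 1 by exact: le_lt_trans r1.
have bnd_term m : `|conj_term C q z (t * q ^+ n) 0 m| <= K1 * (`|q| ^+ n * r) ^+ m.
  rewrite /conj_term (exprMn _ t) invfM.
  have := hH 0%N m; rewrite expr0 mulr1 => h.
  have mE (x u v w : C) : x * u * v * w = x * v * w * u by ring.
  rewrite mE normrM !normrX exprMn.
  have -> : K1 * ((`|q| ^+ n) ^+ m * r ^+ m) = K * 2%:R * r ^+ m * (L * B) * (`|q| ^+ n) ^+ m.
    have pE (x u v w : C) : x * u * (v * w) = x * w * u * v by ring.
    by rewrite /K1 pE.
  rewrite ler_wpM2r ?exprn_ge0// normrM; apply: ler_pM => //.
  by rewrite normrM; apply: ler_pM.
have tail := geo_series_lim_tail _ _ _ _ 1 K10 qr0 qr1 bnd_term.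
rewrite mulrDl; set l := conj_sum _ _.
have -> : 1 - l = (series (conj_term C q z (t * q ^+ n) 0) 1%N - l)
    + (- (t * q ^+ n) * (1 - t * q ^+ n)^-1).
  rewrite seriesEord /= big_ord_recr big_ord0 /= /conj_term qhermite0 qpochS !qpoch0 !expr0.
  by field.
apply: le_trans (ler_normD _ _) _; apply: lerD.
  rewrite distrC; apply: le_trans tail _; rewrite expr1; apply: ler_pM => //.
  - by rewrite mulr_ge0// invr_ge0 subr_ge0 ltW.
  - rewrite ler_wpM2l// lef_pV2 ?posrE ?subr_gt0//.
    by rewrite lerB.
  - by rewrite ler_piMr ?exprn_ge0// ltW.
have := hB n 1%N; rewrite qpochS qpoch0 expr0 mulr1 mul1r => hB1.
rewrite normrM normrN normrM normrX [leLHS]mulrC; apply: ler_pM => //.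
by rewrite ler_piMl ?exprn_ge0// ltW.
Qed.

(** Let [n] tend to infinity in [conj_sum0_iter]. *)
Lemma conj_sum0E t : admissible t ->
  conj_sum t 0 * (qpochoo t q ^+ 2 * qpochoo (t * z ^+ 2) q * qpochoo (t * z ^- 2) q)
  = qpochoo (t ^+ 2) q.
Proof.
move=> ht; rewrite -[RHS]mulr1.
apply: (cvg_uniq (fun n => qpoch (t ^+ 2) q (2 * n) * conj_sum (t * q ^+ n) 0)); last first.
  apply: (@cvgM C); last exact: cvg_conj_sum0.
  have /(@cvgrPdist_lt C C) h := cvg_qpoch _ (t ^+ 2) q q1.
  apply/(@cvgrPdist_lt C C) => e /h[N _ hN]; exists N => // n /= Nn; apply: hN => /=.
  by rewrite (leq_trans Nn)// leq_pmull.
rewrite (_ : (fun n => _) = fun n => conj_sum t 0 * (qpoch t q n * qpoch t q n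
  * qpoch (t * z ^+ 2) q n * qpoch (t * z ^- 2) q n)); last first.
  by apply/funext => n; rewrite -conj_sum0_iter.
apply: (@cvgM C); first exact: cvg_cst.
rewrite expr2; apply: (@cvgM C); last exact: cvg_qpoch.
by apply: (@cvgM C); last exact: cvg_qpoch; apply: (@cvgM C); exact: cvg_qpoch.
Qed.

(** Both sides obey the recurrence of [conj_sum_rec], the right one by [rogers_rec]. At [M = 0] the
    coefficient of the preceding term vanishes, so the single initial value [conj_sum0E]
    suffices. *)
Lemma conj_sumE t M : admissible t ->
  conj_sum t M * (qpochoo t q ^+ 2 * qpochoo (t * z ^+ 2) q * qpochoo (t * z ^- 2) q)
  = qpoch q q M * qpochoo (t ^+ 2 * q ^+ M) q * rogers C q z t M.
Proof.
move=> ht; have [t1 _ _] := ht.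
have t21 : `|t ^+ 2| < 1 by rewrite normrX exprn_ilt1.
set D := (X in conj_sum t M * X).
pose G m := qpoch q q m * qpochoo (t ^+ 2 * q ^+ m) q * rogers C q z t m.
have splitoo m : qpochoo (t ^+ 2 * q ^+ m) q
    = (1 - t ^+ 2 * q ^+ m) * qpochoo (t ^+ 2 * q ^+ m.+1) q.
  by rewrite (qpochoo_split _ _ _ 1 q1) qpochS qpoch0 expr0 mul1r mulr1 -mulrA -exprSr.
have nz m : 1 - t ^+ 2 * q ^+ m != 0.
  by apply: qpoch_neq0S => n; exact: qpoch_lt1_neq0.
have step m : conj_sum t m.-1 * D = G m.-1 -> conj_sum t m * D = G m ->
    conj_sum t m.+1 * D = G m.+1.
  move=> h0 h1; apply: (mulfI (nz m)).
  rewrite mulrA conj_sum_rec// mulrBl -!(mulrA _ _ D) h0 h1 /G (qpochS q q m).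
  have GE : (1 - t ^+ 2 * q ^+ m) * (qpoch q q m * (1 - q * q ^+ m)
      * qpochoo (t ^+ 2 * q ^+ m.+1) q * rogers C q z t m.+1)
    = qpoch q q m * ((1 - t ^+ 2 * q ^+ m) * qpochoo (t ^+ 2 * q ^+ m.+1) q)
      * ((1 - q ^+ m.+1) * rogers C q z t m.+1) by rewrite (exprS q m); ring.
  rewrite GE -splitoo rogers_rec//; case: m {h0 h1 GE} => [|m] /=.
    by rewrite !expr0; ring.
  rewrite (splitoo m) (qpochS q q m) -exprS; ring.
have h0 : conj_sum t 0 * D = G 0%N.
  rewrite /G /D conj_sum0E// qpoch0 expr0 mulr1 mul1r /rogers big_ord_recl big_ord0 /=.
  by rewrite !qpoch0 subrr expr0z addr0 !mulr1 divr1 mulr1.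
(* The induction carries two consecutive indices; they coincide at [M = 0], as [0.-1 = 0]. *)
suff : conj_sum t M.-1 * D = G M.-1 /\ conj_sum t M * D = G M by case.
by elim: M => [|m [IH0 IH1]] //=; split=> //; exact: step.
Qed.

End ConjugateBaileyPair.

Lemma lim_seriesMl (R : realType) (u : nat -> cplx R) (a : cplx R) : geo R u ->
  series (fun n => a * u n) @ \oo --> a * limn (series u).
Proof.
move=> gu; rewrite (_ : series _ = fun n => a * series u n).
  by apply: (@cvgM (cplx R)); [exact: cvg_cst | exact: geo_is_cvg_series].
by apply/funext => n; rewrite !seriesEord /= mulr_sumr.
Qed.

(** * Comparison of the two sides *)

Section Assembly.
Variable R : realType.
Local Notation C := (cplx R).
Variables (k : nat) (q t z : C) (b c : nat -> C).
Hypothesis q1 : `|q| < 1.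
Hypothesis z0 : z != 0.
Hypothesis ht : admissible R z t.
Hypothesis bc0 : forall i, (1 <= i <= k)%N -> b i != 0 /\ c i != 0.
Hypothesis bcq : forall i m, (1 <= i <= k)%N ->
  b i * t * q * q ^+ m != 1 /\ c i * t * q * q ^+ m != 1.

Let t1 : `|t| < 1. Proof. by case: ht. Qed.
Let q_nz n : qpoch q q n != 0. Proof. exact: qpoch_lt1_neq0. Qed.
Let t_nz n : qpoch t q n != 0. Proof. exact: qpoch_lt1_neq0. Qed.
Let t_neq1 : 1 - t != 0.
Proof. by have := qpoch_neq0S t q 0 t_nz; rewrite expr0 mulr1. Qed.

(** [d r (N - r)] is the weight of [alpha_r] in level [N]; up to a factor free of [m], [d r m] is
    the summand of the conjugate sum of index [2r]. *)
Let d r m : C :=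
  t ^+ (r + m) * qhermite C q z (2 * (r + m)) / (qpoch q q m * qpoch (t * q) q (r + r + m)).

Lemma multisum_level_bailey N : multisum_level k q t z b c N =
  \sum_(r < N.+1) bailey_alpha C q t b c k r * d r (N - r).
Proof.
rewrite multisum_levelE bailey_chain// => [|i n hi]; last first.
  by split; apply: qpoch_neq0 => m; have [] := bcq i m hi.
rewrite mulr_suml; apply: eq_bigr => r _; have rN : (r <= N)%N by rewrite -ltnS.
rewrite /d /qhermite subnKC// -addnA subnKC// [(r + N)%N]addnC; ring.
Qed.

(** The decay in [i + m] comes from [t ^+ N] times the q-Hermite polynomial of degree [2 * N] at
    [N = i + m]; the inverse symbols are merely bounded. *)
Lemma conj_coeff_bound : exists K r : C, [/\ 0 <= K, 0 <= r, r < 1 &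
  forall i m, `|d i m| <= K * r ^+ (i + m)].
Proof.
have [y [K [r [_ K0 r0 r1 hH]]]] := expr_qhermite_bound _ _ _ q1 z0 t ht.
have [L L0 hL] := bnd_qpochV _ q q q1; have [B B0 hB] := bnd_qpochV _ (t * q) q q1.
exists (K * 2%:R * (L * B)), r; split=> //; first by rewrite !mulr_ge0.
move=> i m; rewrite /d invfM normrM [leRHS]mulrAC; apply: ler_pM => //.
  by have := hH 0%N (i + m)%N; rewrite expr0 mulr1.
by rewrite normrM; apply: ler_pM.
Qed.

(** [q ^+ 'C(r, 2)] outweighs the [r]-th power of the collected product [e], and the other factors
    are bounded in [r]. *)
Lemma geo_bailey_alpha : geo R (bailey_alpha C q t b c k).
Proof.
have bV (a : C) : bnd R (fun n => (qpoch a q n)^-1) by exact: bnd_qpochV.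
have bP (a : C) : bnd R (fun n => qpoch a q n) by exact: bnd_qpoch.
pose e := \prod_(1 <= i < k.+1) (b i * c i * t * q).
apply: (eq_geo _ _ (fun r => q ^+ 'C(r, 2) * (- e) ^+ r *
  ((1 - t * q ^+ (2 * r)) * qpoch t q r * ((1 - t)^-1 * (qpoch q q r)^-1)
   * \prod_(1 <= i < k.+1) (qpoch (b i)^-1 q r * qpoch (c i)^-1 q r
      * ((qpoch (b i * t * q) q r)^-1 * (qpoch (c i * t * q) q r)^-1))))).
  move=> r; rewrite /bailey_alpha (exprNn e) /e -prodrXl.
  rewrite (eq_bigr (fun i => (b i * c i * t * q) ^+ r * (qpoch (b i)^-1 q r * qpoch (c i)^-1 q r
      * ((qpoch (b i * t * q) q r)^-1 * (qpoch (c i * t * q) q r)^-1)))).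
    by rewrite big_split /= invfM; ring.
  by move=> i _; rewrite invfM; ring.
apply: geoM; first exact: geo_qexpC2.
apply: bndM; first apply: bndM; first apply: bndM => //.
- apply: bndB; first exact: bnd_cst.
  apply: bndM; first exact: bnd_cst.
  by apply: (bnd_comp _ (fun n => q ^+ n)); apply: bnd_expr; exact: ltW.
- by apply: bndM => //; exact: bnd_cst.
- apply: (bnd_prod _ _ _ _ (fun i r => _)) => i _.
  by apply: bndM; apply: bndM.
Qed.

Lemma lim_conj_coeff n : limn (series (d n)) = t ^+ n * (1 - t) * conj_sum R q z t (2 * n).
Proof.
rewrite (_ : d n = fun m => t ^+ n * (1 - t) * conj_term C q z t (2 * n) m).
  by apply: (@cvg_lim C) => //; apply: lim_seriesMl; exact: geo_conj_term.
apply/funext => m; rewrite /d /conj_term mulnDr (mul2n n) addnn qpochSl exprD.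
have := t_neq1; have := q_nz m.
have : qpoch (t * q) q (n.*2 + m) != 0.
  by have := t_nz (n.*2 + m).+1; rewrite qpochSl mulf_eq0 negb_or => /andP[].
by move=> h1 h2 h3; field; rewrite h1 h2 h3.
Qed.

(** By [conj_sumE] the limit has [(t; q)_oo] squared in its denominator, and the prefactor cancels
    one copy. Splitting the other at [n], [2n] and [2n + 1] produces the symbols in [rhs_term]. *)
Lemma rhs_termE n : rhs_term k q t z b c n =
  (qpochoo t q * qpochoo (t * z ^+ 2) q * qpochoo (t * z ^- 2) q)
  * (bailey_alpha C q t b c k n * limn (series (d n))).
Proof.
rewrite lim_conj_coeff.
have [_ tz tzV] := ht.
have too : qpochoo t q != 0 by exact: qpochoo_neq0.
have := conj_sumE R q z q1 z0 t (2 * n) ht.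
set S := conj_sum _ _ _ _ _; set D1 := qpochoo (t * z ^+ 2) q.
set D2 := qpochoo (t * z ^- 2) q => hS.
have SE : S * D1 * D2 = qpoch q q (2 * n) * qpochoo (t ^+ 2 * q ^+ (2 * n)) q
    * rogers C q z t (2 * n) / qpochoo t q ^+ 2.
  by rewrite -hS; field; rewrite too.
have -> : qpochoo t q * D1 * D2 * (bailey_alpha C q t b c k n * (t ^+ n * (1 - t) * S))
  = qpochoo t q * (bailey_alpha C q t b c k n * (t ^+ n * (1 - t))) * (S * D1 * D2) by ring.
rewrite SE /rhs_term -/(rogers C q z t (2 * n)).
have tooE : qpochoo t q = qpoch t q n * qpoch (t * q ^+ n) q n
     * (1 - t * q ^+ (2 * n)) * qpochoo (t * q ^+ (2 * n).+1) q.
  by rewrite (qpochoo_split _ _ _ (2 * n).+1 q1) qpochS mul2n -addnn qpochD.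
have q2n : qpoch q q (2 * n) = qpoch q q n * qpoch (q ^+ n.+1) q n.
  by rewrite mul2n -addnn qpochD exprS.
have alE : bailey_alpha C q t b c k n = (-1) ^+ n * q ^+ 'C(n, 2) * (1 - t * q ^+ (2 * n))
   * qpoch t q n / ((1 - t) * qpoch q q n)
   * ((\prod_(1 <= i < k.+1) (qpoch (b i)^-1 q n * qpoch (c i)^-1 q n))
     * (\prod_(1 <= i < k.+1) (b i * c i)) ^+ n * (t ^+ (k * n) * q ^+ (k * n))
     / \prod_(1 <= i < k.+1)
         (qpoch (b i * t * q) q n * qpoch (c i * t * q) q n)).
  rewrite /bailey_alpha; congr (_ * _).
  rewrite -[X in _ / X]invrK -prodfV invrK -prodrXl -big_split /=.
  have -> : t ^+ (k * n) * q ^+ (k * n) = \prod_(1 <= i < k.+1) (t * q) ^+ n.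
    by rewrite prodr_const_nat subSS subn0 -exprM mulnC exprMn.
  rewrite -!big_split /=; apply: eq_bigr => i _.
  by rewrite -(mulrA (b i * c i)) (exprMn _ (b i * c i)); ring.
rewrite alE q2n tooE.
have := t_neq1; have := q_nz n; have := too; rewrite tooE !mulf_eq0 !negb_or.
move=> /andP[/andP[/andP[h1 h2] h3] h4] h5 h6.
rewrite mulSn (exprD t) (exprD q).
move: (\prod_(1 <= i < k.+1) (qpoch (b i * t * q) q n * qpoch (c i * t * q) q n))^-1 => PV.
move: (\prod_(1 <= i < k.+1) (b i * c i)) => P2.
move: (\prod_(1 <= i < k.+1) _) => P1; move: h1 h2 h3 h4 h5 h6.
move: (qpoch t q n) (qpoch (t * q ^+ n) q n) (qpochoo (t * q ^+ (2 * n).+1) q) => T1 T2 T3.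
move: (qpoch (q ^+ n.+1) q n) (qpochoo (t ^+ 2 * q ^+ (2 * n)) q) (rogers _ _ _ _ _) => Q2 T4 P.
move: (qpoch q q n) (q ^+ (2 * n)) ((-1) ^+ n) (q ^+ 'C(n, 2)) (P2 ^+ n) => Q1 q2 s qC P2n.
move: (t ^+ n) (t ^+ (k * n)) (q ^+ (k * n)) => tn tkn qkn h1 h2 h3 h4 h5 h6.
by field; rewrite h1 h2 h3 h4 h5 h6.
Qed.

End Assembly.

Theorem theorem4p1 (R : realType) (k : nat) (q t z : cplx R)
    (b c : nat -> cplx R) :
  (1 <= k)%N ->
  `|q| < 1 -> `|t| < 1 -> z != 0 ->
  (forall i, (1 <= i <= k)%N -> b i != 0 /\ c i != 0) ->
  (* the denominators (b_i t q;q)_n and (c_i t q;q)_n do not vanish *)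
  (forall i m, (1 <= i <= k)%N ->
     b i * t * q * q ^+ m != 1 /\ c i * t * q * q ^+ m != 1) ->
  (* the series over n_k converges *)
  `|t * z ^+ 2| < 1 -> `|t * z ^- 2| < 1 ->
  [/\ cvgn (series (multisum_level k q t z b c)),
      cvgn (series (rhs_term k q t z b c)) &
      limn (series (multisum_level k q t z b c))
      = 1 / (qpochoo t q * qpochoo (t * z ^+ 2) q * qpochoo (t * z ^- 2) q)
        * limn (series (rhs_term k q t z b c))].
Proof.
move=> _ q1 t1 z0 bc0 bcq tz tzV.
have ht : admissible R z t by split.
have [K [r [K0 r0 r1 hd]]] := conj_coeff_bound R q t z q1 z0 ht.
have gal := geo_bailey_alpha R k q t b c q1.
(* The level series sums the double series along [r + m = N]; the exchange sums it by [r] first. *)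
have [gag cv] := cvg_series_exchange R _ _ K r gal K0 r0 r1 hd.
set D := qpochoo t q * _ * _.
have D0 : D != 0.
  by rewrite !mulf_neq0// qpochoo_neq0// => n; exact: qpoch_lt1_neq0.
have lE : multisum_level k q t z b c = _ :=
  funext (multisum_level_bailey R k q t z b c q1 ht bc0 bcq).
have rE : rhs_term k q t z b c = _ := funext (rhs_termE R k q t z b c q1 z0 ht).
rewrite -lE in cv.
(* By [rhs_termE] the right-hand series is [D] times the exchanged one; the nonzero [D] cancels at
   the end. *)
have cv' := lim_seriesMl R _ D gag; rewrite -rE in cv'.
split; first by apply/cvg_ex; eexists; exact: cv.
  by apply/cvg_ex; eexists; exact: cv'.
rewrite (cvg_lim (@norm_hausdorff _ _) cv) (cvg_lim (@norm_hausdorff _ _) cv').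
by rewrite mul1r mulKf.
Qed.
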